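(* Let $\mathbb A=\mathbb A(R,\Lambda)$ be a model space of dimension at least $2$ (i.e. $R$ has rank at least $2$), with full affine Weyl group $W$ (that is, $T=\mathbb A$) and a Weyl compatible metric $d$, and suppose that $\Lambda$ contains a sequence $0<\lambda_1<\lambda_2<\cdots$ converging to infinity. Then there exists a space $(X,\mathcal A)$ modeled on $\mathbb A$ which satisfies axioms (A1), (A2), (A3), (A4) and (A6), but satisfies neither (A5) nor (TI).
   Context: **Model space.** $R$ is a (not necessarily crystallographic) spherical root system with co-roots $\alpha^\vee$; $F\subseteq\mathbb R$ is a subfield containing all $\langle\beta,\alpha^\vee\rangle$, $\alpha,\beta\in R$; $\Lambda$ is a totally ordered abelian group with an $F$-module structure (positive elements of $F$ preserve the order). A sequence in $\Lambda$ converges to infinity if it eventually exceeds every element of $\Lambda$. Put $\mathbb A=\mathbb A(R,\Lambda)=\mathrm{span}_F(R)\otimes_F\Lambda$, with the natural action of the spherical Weyl group $\overline W$, and $W=\overline W\ltimes\mathbb A$. An affine reflection is an element $t\circ r_\alpha\in W$ ($t$ a translation, $r_\alpha$ a reflection of $\overline W$) with nonempty fixed point set; this set is called a hyperplane. A hyperplane bounds two half-apartments, each containing the hyperplane. It separates $x,y$ if they lie in different open half-spaces. A closed convex set is an intersection of finitely many half-apartments. Fix a basis $B=\{\alpha_i\}$ of $R$. The fundamental Weyl chamber is $\mathcal C_f=\{x:\langle x,\alpha^\vee\rangle\ge 0\ \forall \alpha\in B\}$; Weyl chambers are its images under $W$; Weyl simplices (sector faces) are faces of Weyl chambers; panels are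 Weyl simplices of codimension one. A sub-Weyl chamber (sub-face) of a Weyl simplex is a translate of it contained in it. The panel of $\mathcal C_f$ on which $\langle\cdot,\alpha_i^\vee\rangle=0$ has type $i$; the type of a face of $\mathcal C_f$ is the union of the types of the panels containing it; the type of a Weyl simplex is the type of the unique face of $\mathcal C_f$ of which it is a $W$-image. **Metric.** $d$ is a $W$-invariant $\Lambda$-metric on $\mathbb A$ (values in $\Lambda$, usual metric axioms). $\mathrm{seg}_{\mathbb A}(x,y)=\{z: d(x,y)=d(x,z)+d(z,y)\}$. It is *Weyl compatible* if: (1) for all Weyl chambers $S$ and all Weyl simplices $P_1,P_2$ of the same type: if there is $\lambda\in\Lambda$ such that for every sub-face $P_1'\subset P_1$ there is a sub-face $P_2'\subset P_2$ such that for each $y\in P_2'$ there is $x\in P_1'$ with $|d(v,y)-d(v,x)|\le\lambda$ for all $v\in S$, then $P_1,P_2$ are translates of one another; (2) whenever a hyperplane $H$ separates $x$ and $y$, $\mathrm{seg}_{\mathbb A}(x,y)\cap H\ne\emptyset$. **Spaces.** A space modeled on $\mathbb A$ is a set $X$ with a collection $\mathcal A$ of injective maps $f:\mathbb A\to X$ (charts) whose images cover $X$. The images $f(\mathbb A)$ are apartments; Weyl chambers, half-apartments, etc. of $X$ are images of such under charts. (A1) $\mathcal A$ is invariant under pre-composition with elements of $W$. (A2) If $f,g\in\mathcal A$ and $f(\mathbb A)\cap g(\mathbb A)\neq\emptyset$, then $f^{-1}(g(\mathbb A))$ is closed convex and there is $w\in W$ with $f=g\circ w$ on $f^{-1}(g(\mathbb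 A))$. (A3) Any two points of $X$ lie in a common apartment. By (A1)–(A3), $d(x,y)$ is defined on $X$ as the distance of the preimages of $x,y$ under any chart whose apartment contains both. (A4) Any two Weyl chambers of $X$ have sub-Weyl chambers contained in a common apartment. (A5) For every apartment $A$ and $x\in A$ there is a retraction $r_{A,x}:X\to A$ (identity on $A$) that does not increase distances and satisfies $r_{A,x}^{-1}(x)=\{x\}$. (A6) If $f,g,h$ are charts whose apartments pairwise intersect in half-apartments, then $f(\mathbb A)\cap g(\mathbb A)\cap h(\mathbb A)\ne\emptyset$. (TI) $d$ on $X$ satisfies the triangle inequality. *)

(* Defs.v *)
From HB Require Import structures.
From mathcomp Require Import all_boot all_order all_algebra.
From mathcomp Require Import boolp classical_sets reals.

Set Implicit Arguments.
Unset Strict Implicit.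
Unset Printing Implicit Defensive.

Import Order.TTheory GRing.Theory Num.Theory.
Local Open Scope quotient_scope.
Local Open Scope classical_set_scope.
Local Open Scope ring_scope.

Record subfield (K : fieldType) (F : divringClosed K) :=
  Subfield { sfval : K; sfvalP : sfval \in F }.

Section SubfieldInstances.
Variables (K : fieldType) (F : divringClosed K).
HB.instance Definition _ := [isSub for @sfval K F].
HB.instance Definition _ := [Choice of subfield F by <:].
HB.instance Definition _ := [SubChoice_isSubIntegralDomain of subfield F by <:].
HB.instance Definition _ := [SubIntegralDomain_isSubField of subfield F by <:].
End SubfieldInstances.

(* Totally ordered abelian groups with an F-module structure for which        *)
(* multiplication by positive elements of F preserves the order.              *)
HB.mixin Record Lmodule_isOrdered (K : realType) (F : divringClosed K) L
    of Num.POrderedZmodule L & GRing.Lmodule (subfield F) L := {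
  lmod_le_total : forall x y : L, (x <= y) || (y <= x);
  lmod_lerD2r : forall z x y : L, x <= y -> x + z <= y + z;
  lmod_ler_scale : forall (a : subfield F) (x y : L),
    0 < sfval a -> x <= y -> a *: x <= a *: y
}.

#[short(type="orderedLmodType")]
HB.structure Definition OrderedLmodule (K : realType) (F : divringClosed K) :=
  { L of Num.POrderedZmodule L & GRing.Lmodule (subfield F) L &
         Lmodule_isOrdered K F L }.

(* The tensor product of two modules over a commutative ring: formal finite   *)
(* sums of pure tensors, two of them being identified when no bilinear map    *)
(* distinguishes them.                                                        *)
Section Tensor.
Variables (F : comNzRingType) (V M : lmodType F).

Definition teval (N : nmodType) (f : V -> M -> N) (s : seq (V * M)) : N :=
  \sum_(p <- s) f p.1 p.2.

Definition teq (s t : seq (V * M)) : bool :=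
  `[< forall (N : lmodType F) (f : {bilinear V -> M -> N}),
        teval f s = teval f t >].

Lemma teq_is_equiv : equiv_class_of teq.
Proof.
split=> [s|s t|t s u].
- by apply/asboolP.
- by apply/idP/idP => /asboolP h; apply/asboolP => N f; rewrite h.
- by move=> /asboolP h1 /asboolP h2; apply/asboolP => N f; rewrite h1 h2.
Qed.

Canonical teq_equiv := EquivRelPack teq_is_equiv.

Definition tensor : Type := {eq_quot teq}.
HB.instance Definition _ : EqQuotient _ teq tensor := EqQuotient.on tensor.
HB.instance Definition _ := Choice.on tensor.

Definition tens (v : V) (m : M) : tensor := \pi_tensor [:: (v, m)].

Definition tzero : tensor := \pi_tensor [::].
Definition tadd (x y : tensor) : tensor := \pi_tensor (repr x ++ repr y).
Definition tscale (a : F) (x : tensor) : tensor :=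
  \pi_tensor [seq (a *: p.1, p.2) | p <- repr x].

(* The map induced by f on the tensor product; meaningful for f bilinear. *)
Definition tlift (N : nmodType) (f : V -> M -> N) (x : tensor) : N :=
  teval f (repr x).

Lemma tlift_pi (N : lmodType F) (f : {bilinear V -> M -> N}) s :
  tlift f (\pi_tensor s) = teval f s.
Proof.
have /eqmodP/asboolP : repr (\pi_tensor s) = s %[mod tensor] by rewrite reprK.
exact.
Qed.

Lemma tensor_ext (x y : tensor) :
  (forall (N : lmodType F) (f : {bilinear V -> M -> N}),
     tlift f x = tlift f y) -> x = y.
Proof. by move=> h; rewrite -[x]reprK -[y]reprK; apply/eqmodP/asboolP. Qed.

Lemma tlift0 (N : lmodType F) (f : {bilinear V -> M -> N}) :
  tlift f tzero = 0.
Proof. by rewrite tlift_pi /teval big_nil. Qed.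

Lemma tliftD (N : lmodType F) (f : {bilinear V -> M -> N}) x y :
  tlift f (tadd x y) = tlift f x + tlift f y.
Proof. by rewrite tlift_pi /teval big_cat. Qed.

Lemma tliftZ (N : lmodType F) (f : {bilinear V -> M -> N}) a x :
  tlift f (tscale a x) = a *: tlift f x.
Proof.
rewrite tlift_pi /tlift /teval big_map scaler_sumr.
by apply: eq_bigr => p _ /=; rewrite linearZl_LR.
Qed.

Definition tliftE := (tlift0, tliftD, tliftZ).

Lemma taddA : associative tadd.
Proof. by move=> x y z; apply: tensor_ext => N f; rewrite !tliftE addrA. Qed.

Lemma taddC : commutative tadd.
Proof. by move=> x y; apply: tensor_ext => N f; rewrite !tliftE addrC. Qed.

Lemma tadd0 : left_id tzero tadd.
Proof. by move=> x; apply: tensor_ext => N f; rewrite !tliftE add0r. Qed.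

Lemma taddN : left_inverse tzero (tscale (-1)) tadd.
Proof.
by move=> x; apply: tensor_ext => N f; rewrite !tliftE scaleN1r addNr.
Qed.

HB.instance Definition _ :=
  GRing.isZmodule.Build tensor taddA taddC tadd0 taddN.

Lemma tscaleA a b x : tscale a (tscale b x) = tscale (a * b) x.
Proof. by apply: tensor_ext => N f; rewrite !tliftE scalerA. Qed.

Lemma tscale1 : left_id 1 tscale.
Proof. by move=> x; apply: tensor_ext => N f; rewrite !tliftE scale1r. Qed.

Lemma tscaleDr : right_distributive tscale +%R.
Proof. by move=> a x y; apply: tensor_ext => N f; rewrite !tliftE scalerDr. Qed.

Lemma tscaleDl x : {morph tscale^~ x : a b / a + b}.
Proof. by move=> a b; apply: tensor_ext => N f; rewrite !tliftE scalerDl. Qed.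

HB.instance Definition _ :=
  GRing.Zmodule_isLmodule.Build F tensor tscaleA tscale1 tscaleDr tscaleDl.

End Tensor.

(* (f \otimes id) for a linear endomorphism f of V. *)
Definition tmap (F : comNzRingType) (V M : lmodType F) (f : V -> V) :
    tensor V M -> tensor V M :=
  tlift (fun v m => tens (f v) m).

Section RootSystem.
Variables (K : realType) (n : nat).
Implicit Types (u v a b : 'rV[K]_n) (Phi : seq 'rV[K]_n).

Definition dot u v : K := \sum_i u 0 i * v 0 i.

(* <v, a^\vee> *)
Definition cpair v a : K := 2 * dot v a / dot a a.

Definition vec_refl a v : 'rV[K]_n := v - cpair v a *: a.

(* Phi is the finite set of the members of the sequence. *)
Definition is_root_system Phi : Prop :=
  [/\ 0 \notin Phi,
      forall a b, a \in Phi -> b \in Phi -> vec_refl a b \in Phi &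
      forall v, exists c : 'rV[K]_n -> K, v = \sum_(a <- Phi) c a *: a].

(* Phi spans K^n, so a basis has n elements. *)
Definition is_basis Phi (B : 'I_n -> 'rV[K]_n) : Prop :=
  [/\ forall i, B i \in Phi,
      row_free (\matrix_(i < n) B i) &
      forall a, a \in Phi -> exists2 c : 'I_n -> K,
        a = \sum_i c i *: B i &
        (forall i, 0 <= c i) \/ (forall i, c i <= 0)].

End RootSystem.

(* span_F(Phi), with F acting by restriction of scalars. *)
Section Span.
Variables (K : realType) (n : nat) (F : divringClosed K) (Phi : seq 'rV[K]_n).

Definition in_span (v : 'rV[K]_n) : bool :=
  `[< exists c : 'rV[K]_n -> subfield F,
        v = \sum_(a <- Phi) sfval (c a) *: a >].

Lemma in_span_zmod : zmod_closed in_span.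
Proof.
split=> [|u v /asboolP[c ->] /asboolP[d ->]]; apply/asboolP.
  by exists (fun=> 0); rewrite big1 // => a _; rewrite scale0r.
exists (fun a => c a - d a); rewrite -sumrB; apply: eq_bigr => a _.
by rewrite -scalerBl.
Qed.

Lemma in_spanZ (x : subfield F) v : in_span v -> in_span (sfval x *: v).
Proof.
move=> /asboolP[c ->]; apply/asboolP; exists (fun a => x * c a).
by rewrite scaler_sumr; apply: eq_bigr => a _; rewrite scalerA.
Qed.

HB.instance Definition _ := GRing.isZmodClosed.Build _ in_span in_span_zmod.

Record rspan := Rspan { rspan_val : 'rV[K]_n; rspanP : rspan_val \in in_span }.
HB.instance Definition _ := [isSub for rspan_val].
HB.instance Definition _ := [Choice of rspan by <:].
HB.instance Definition _ := [SubChoice_isSubZmodule of rspan by <:].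

Definition rspan_scale (x : subfield F) (v : rspan) : rspan :=
  Rspan (in_spanZ x (rspanP v)).

Lemma rspan_scaleA x y v :
  rspan_scale x (rspan_scale y v) = rspan_scale (x * y) v.
Proof. by apply: val_inj; rewrite /= scalerA. Qed.

Lemma rspan_scale1 : left_id 1 rspan_scale.
Proof. by move=> v; apply: val_inj; rewrite /= scale1r. Qed.

Lemma rspan_scaleDr : right_distributive rspan_scale +%R.
Proof. by move=> x u v; apply: val_inj; rewrite /= scalerDr. Qed.

Lemma rspan_scaleDl v : {morph rspan_scale^~ v : x y / x + y}.
Proof. by move=> x y; apply: val_inj; rewrite /= scalerDl. Qed.

HB.instance Definition _ := GRing.Zmodule_isLmodule.Build (subfield F) rspan
  rspan_scaleA rspan_scale1 rspan_scaleDr rspan_scaleDl.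

(* When a is in Phi and F contains all <b, a^\vee>, the default values of     *)
(* insubd in the next two definitions are not used.                           *)
Definition coroot (a : 'rV[K]_n) (v : rspan) : subfield F :=
  insubd 0 (cpair (rspan_val v) a).

Definition span_refl (a : 'rV[K]_n) (v : rspan) : rspan :=
  insubd v (vec_refl a (rspan_val v)).

Inductive weyl : (rspan -> rspan) -> Prop :=
| weyl_id : weyl id
| weyl_refl a w : a \in Phi -> weyl w -> weyl (span_refl a \o w).

End Span.

Section Model.
Variables (K : realType) (n : nat) (F : divringClosed K).
Variables (Phi : seq 'rV[K]_n) (L : orderedLmodType F).

Definition model : lmodType (subfield F) := tensor (rspan F Phi) L.

Implicit Types (a : 'rV[K]_n) (t x y z : model) (H D C P S : set model).

Definition pairing a x : L := tlift (fun v l => coroot a v *: l) x.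

Definition affW : set (model -> model) :=
  [set w | exists2 w0, weyl w0 & exists t, w = fun x => t + tmap w0 x].

Definition affine_fix a t : set model := [set x | t + tmap (span_refl a) x = x].

Definition is_hyperplane H : Prop :=
  exists a t, [/\ a \in Phi, H = affine_fix a t & H !=set0].

(* pairing a is constant on affine_fix a t; the opposite side is obtained     *)
(* from the root - a.                                                         *)
Definition is_half_apartment D : Prop :=
  exists a t p, [/\ a \in Phi, affine_fix a t p &
    D = [set x | pairing a p <= pairing a x]].

Definition separates H x y : Prop :=
  exists a t p, [/\ a \in Phi, H = affine_fix a t, H p &
    (pairing a x < pairing a p /\ pairing a p < pairing a y)
    \/ (pairing a y < pairing a p /\ pairing a p < pairing a x)].

Definition closed_convex C : Prop :=
  exists m (D : 'I_m -> set model),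
    (forall i, is_half_apartment (D i)) /\ C = [set x | forall i, D i x].

Definition translate t P : set model := [set t + x | x in P].

(* Sub-Weyl chambers are the sub-faces of Weyl chambers. *)
Definition is_subface P' P : Prop :=
  (exists t, P' = translate t P) /\ P' `<=` P.

Section Chambers.
Variable B : 'I_n -> 'rV[K]_n.

Definition fund_chamber : set model :=
  [set x | forall i, 0 <= pairing (B i) x].

Definition fund_panel (i : 'I_n) : set model :=
  fund_chamber `&` [set x | pairing (B i) x = 0].

Definition is_fund_face P : Prop :=
  exists J : set 'I_n,
    P = fund_chamber `&` [set x | forall i, J i -> fund_panel i x].

Definition face_type P : set 'I_n := [set i | P `<=` fund_panel i].

Definition is_weyl_chamber S : Prop :=
  exists2 w, affW w & S = w @` fund_chamber.

Definition is_simplex_of_type (J : set 'I_n) P : Prop :=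
  exists w Q, [/\ affW w, is_fund_face Q, face_type Q = J & P = w @` Q].

Variable d : model -> model -> L.

Definition is_metric : Prop :=
  [/\ forall x y, 0 <= d x y,
      forall x y, d x y = 0 <-> x = y,
      forall x y, d x y = d y x &
      forall x y z, d x z <= d x y + d y z].

Definition W_invariant : Prop :=
  forall w, affW w -> forall x y, d (w x) (w y) = d x y.

Definition seg x y : set model := [set z | d x y = d x z + d z y].

Definition labs (l : L) : L := Order.max l (- l).

Definition weyl_compatible : Prop :=
  (forall S J P1 P2, is_weyl_chamber S ->
     is_simplex_of_type J P1 -> is_simplex_of_type J P2 ->
     (exists l : L, forall P1', is_subface P1' P1 ->
        exists2 P2', is_subface P2' P2 &
        forall y, P2' y -> exists2 x, P1' x &
        forall v, S v -> labs (d v y - d v x) <= l) ->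
     exists t, P2 = translate t P1) /\
  (forall H x y, is_hyperplane H -> separates H x y -> seg x y `&` H !=set0).

Section Spaces.
Variables (X : Type) (charts : set (model -> X)).

Definition modeled_space : Prop :=
  (forall f, charts f -> injective f) /\
  (forall p : X, exists2 f, charts f & range f p).

(* The distance on X; well defined under (A1)-(A3). *)
Definition dX (p q : X) : L :=
  xget 0 [set l | exists f x y, [/\ charts f, f x = p, f y = q & l = d x y]].

Definition is_half_apartment_in (E : set X) : Prop :=
  exists f D, [/\ charts f, is_half_apartment D & E = f @` D].

Definition is_weyl_chamber_in (E : set X) : Prop :=
  exists f S, [/\ charts f, is_weyl_chamber S & E = f @` S].

Definition is_subchamber_in (E' E : set X) : Prop :=
  exists f S S', [/\ charts f, is_weyl_chamber S, is_subface S' S,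
    E = f @` S & E' = f @` S'].

Definition axiomA1 : Prop :=
  forall f w, charts f -> affW w -> charts (f \o w).

Definition axiomA2 : Prop :=
  forall f g, charts f -> charts g -> range f `&` range g !=set0 ->
    closed_convex (f @^-1` range g) /\
    exists2 w, affW w & forall x, (f @^-1` range g) x -> f x = g (w x).

Definition axiomA3 : Prop :=
  forall p q : X, exists f, [/\ charts f, range f p & range f q].

Definition axiomA4 : Prop :=
  forall E1 E2, is_weyl_chamber_in E1 -> is_weyl_chamber_in E2 ->
    exists E1' E2' f, [/\ is_subchamber_in E1' E1, is_subchamber_in E2' E2,
      charts f, E1' `<=` range f & E2' `<=` range f].

Definition axiomA5 : Prop :=
  forall f p, charts f -> range f p ->
    exists r : X -> X,
      [/\ forall q, range f (r q),
          forall q, range f q -> r q = q,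
          forall q q', dX (r q) (r q') <= dX q q' &
          r @^-1` [set p] = [set p]].

Definition axiomA6 : Prop :=
  forall f g h, charts f -> charts g -> charts h ->
    is_half_apartment_in (range f `&` range g) ->
    is_half_apartment_in (range f `&` range h) ->
    is_half_apartment_in (range g `&` range h) ->
    range f `&` range g `&` range h !=set0.

Definition axiomTI : Prop := forall p q r : X, dX p r <= dX p q + dX q r.

End Spaces.
End Chambers.
End Model.

(* Main.v *)
Require Import Defs.
From HB Require Import structures.
From mathcomp Require Import all_boot all_order all_algebra.
From mathcomp Require Import boolp classical_sets reals.
From mathcomp Require Import ring.

Set Implicit Arguments.
Unset Strict Implicit.
Unset Printing Implicit Defensive.

Import Order.TTheory GRing.Theory Num.Theory.
Local Open Scope classical_set_scope.
Local Open Scope ring_scope.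

(** The space is built freely. Fix lambda > 0. In the model space consider, for
    every Weyl chamber based at 0, the set of its points whose pairing with
    every root has absolute value at least lambda; such a set is a cell, and so
    is every other single point. Start from two disjoint apartments and, at
    each stage, add for any two cells not yet in a common apartment a new
    apartment meeting the older ones exactly in these two cells: chamber cells
    are glued by spherical Weyl group elements, and single points are placed at
    two fixed points 0 and Y. Every apartment stays a union of cells, and two
    distinct apartments meet in at most one cell. This gives (A2), since cells
    are closed convex, and (A6) vacuously, since in rank at least 2 no cell
    contains a half-apartment; (A3) and (A4) hold because any two cells are
    eventually joined and every Weyl chamber has a sub-chamber inside a cell.
    Hyperplanes cut segments, so Y and Z can be chosen with
    2 d(0, Y) < d(0, Z). Both 0 and Z in the first initial apartment end up at
    distance d(0, Y) from 0 in the second one, which contradicts (TI), and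
    hence (A5). *)

(** * Free amalgamation of apartments *)

(** [deep] will only be a partial equivalence relation: a point outside its domain forms a cell by
    itself. *)
Definition cell (A : Type) (deep : A -> A -> Prop) (x : A) : set A :=
  [set y | y = x \/ deep x y].

(* In the application A is the model space, [lin] and [aff] are the spherical
   and affine Weyl groups, and [deep x y] means that x and y lie in the same
   chamber cell; [r] is a reflection, used to separate two such cells. *)
Section FreeSpace.
Variables (A : Type) (lin aff : (A -> A) -> Prop) (deep : A -> A -> Prop).
Hypothesis lin_id : lin id.
Hypothesis lin_comp : forall u w, lin u -> lin w -> lin (u \o w).
Hypothesis lin_inv : forall u, lin u -> exists2 w,
  lin w & cancel w u /\ cancel u w.
Hypothesis lin_aff : forall u, lin u -> aff u.
Hypothesis aff_inj : forall w, aff w -> injective w.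
Hypothesis aff_trans : forall x y, exists2 w, aff w & w x = y.
Hypothesis deep_sym : forall x y, deep x y -> deep y x.
Hypothesis deep_trans : forall y x z, deep x y -> deep y z -> deep x z.
Hypothesis deep_lin : forall u x y, lin u -> deep x y -> deep (u x) (u y).
Variables (r : A -> A) (o e : A).
Hypothesis r_lin : lin r.
Hypothesis deep_r : forall x y, deep x y -> ~ deep x (r y).
Hypothesis o_neq_e : o <> e.
Hypothesis not_deep_o : ~ deep o o.
Hypothesis not_deep_e : ~ deep e e.

Let deep_refl x y : deep x y -> deep x x.
Proof. by move=> xy; apply: deep_trans xy (deep_sym xy). Qed.

Let deep_refr x y : deep x y -> deep y y.
Proof. by move/deep_sym/deep_refl. Qed.

Let deep_lin_inv u x y : lin u -> deep (u x) (u y) -> deep x y.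
Proof.
move=> uW uxy; have [w wW [_ uK]] := lin_inv uW.
by rewrite -[x]uK -[y]uK; apply: deep_lin.
Qed.

Local Notation cell := (cell deep).

Let cell_deepl x y : cell x y -> deep x x -> deep x y.
Proof. by case=> [->|]. Qed.

Let cell_deepr x y : cell x y -> deep y y -> deep x x.
Proof. by case=> [->|/deep_refl]. Qed.

Let cell_trans x y z : cell x y -> deep y z -> cell x z.
Proof. by case=> [->|xy yz]; right => //; apply: deep_trans yz. Qed.

(* [New k phi] is the apartment added at stage [k], glued to the older ones
   along the domain of the partial map [phi]. A point is recorded by the
   apartment with which it was created and its coordinate there. *)
Inductive label := Base of bool | New of nat & (A -> option (label * A)).

Definition point := (label * A)%type.

(** Gluing needs no quotient: a glued coordinate returns the name of an old point, and any other
    coordinate names a fresh point by the label of its own apartment. *)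
Definition chart (N : label) (x : A) : point :=
  if N is New _ phi then if phi x is Some p then p else (N, x) else (N, x).

(** An apartment added at stage [k] gets a level above those of all points present at that stage, so
    its fresh points differ from the old ones. *)
Definition level (N : label) : nat := if N is New k _ then k.+1 else 0%N.

(** * One stage: cells of points, requests and gluings *)

Section Stage.
Variable I : set label.

Definition occurs (p : point) := exists N x, I N /\ p = chart N x.

(** Under [coherent] the choice of the apartment [N] is immaterial, as [chart_same_cell] shows. *)
Definition same_cell (p q : point) := p = q \/
  exists N x y, [/\ I N, p = chart N x, q = chart N y & deep x y].

Definition joined (p q : point) :=
  exists N x y, [/\ I N, p = chart N x & q = chart N y].

(** The disjunction makes deepness independent of the chart: the transition is linear, hence
    preserves and reflects [deep], so depth on either side gives depth on the other. *)
Definition compatible (phi : A -> option point) :=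
  forall M x u, I M -> phi x = Some (chart M u) -> deep x x \/ deep u u ->
  exists2 w, lin w & u = w x /\
    forall y, deep x y -> phi y = Some (chart M (w y)).

(** The last clause pins glued shallow coordinates to [o] and [e]; this later fixes the distances
    between the two initial apartments. *)
Definition gluing (U : set point) (phi : A -> option point) :=
  [/\ forall x y p, phi x = Some p -> phi y = Some p -> x = y,
      compatible phi,
      forall p, U p <-> exists x, phi x = Some p &
      forall x, phi x <> None -> deep x x \/ (x = o \/ x = e)].

(** Recording the union of the two cells rather than a pair of points makes all requests for the
    same two cells equal, so a single apartment serves them. *)
Definition request (U : set point) := exists p q,
  [/\ occurs p, occurs q, ~ joined p q &
      U = [set s | same_cell p s \/ same_cell q s]].

(** Within a stage the choice depends on [U] alone, so a request determines its label. The empty map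
    is a default, ruled out for requests by [gluing_exists]. *)
Definition chosen_gluing (U : set point) : A -> option point :=
  if pselect (exists phi, gluing U phi) is left exphi
  then projT1 (cid exphi) else fun=> None.

Definition coherent :=
  forall N, I N -> injective (chart N) /\ compatible (Some \o chart N).

Hypothesis Icoh : coherent.

Lemma same_cell_occurs p q : occurs p -> same_cell p q -> occurs q.
Proof. by move=> pI [<-//|[N [x [y [NI _ -> _]]]]]; exists N, y. Qed.

(** Cells can be followed backwards through [phi] because the transition on a deep cell is an
    invertible linear map. *)
Lemma compatible_same_cell phi x p q :
  compatible phi -> phi x = Some p -> same_cell p q ->
  exists2 y, cell x y & phi y = Some q.
Proof.
move=> phic xp [<-|[M [u [v [MI pu -> uv]]]]]; first by exists x => //; left.
rewrite pu in xp; have [|w wW [uw wE]] := phic _ _ _ MI xp.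
  by right; apply: deep_refl uv.
have [w' w'W [wK Kw]] := lin_inv wW.
have xw'v : deep x (w' v) by apply: (deep_lin_inv wW); rewrite -uw wK.
by exists (w' v); [right | rewrite wE // wK].
Qed.

Lemma compatible_cell phi x p y :
  compatible phi -> phi x = Some p -> occurs p -> cell x y ->
  exists2 q, phi y = Some q & same_cell p q.
Proof.
move=> phic xp [M [u [MI pu]]] [->|xy]; first by exists p => //; left.
rewrite pu in xp; have [|w wW [uw wE]] := phic _ _ _ MI xp.
  by left; apply: deep_refl xy.
exists (chart M (w y)); first exact: wE.
by right; exists M, u, (w y); split=> //; rewrite uw; apply: deep_lin.
Qed.

Lemma chart_same_cell N x q : I N -> same_cell (chart N x) q ->
  exists2 y, cell x y & q = chart N y.
Proof.
move=> NI /(compatible_same_cell (Icoh NI).2 erefl)[y xy [<-]].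
by exists y.
Qed.

Lemma chart_cell N x y : I N -> cell x y -> same_cell (chart N x) (chart N y).
Proof.
by move=> NI [->|xy]; [left | right; exists N, x, y].
Qed.

Lemma same_cell_sym p q : same_cell p q -> same_cell q p.
Proof.
move=> [->|[N [x [y [NI -> -> xy]]]]]; first by left.
by right; exists N, y, x; split=> //; apply: deep_sym.
Qed.

Lemma same_cell_trans q p s : same_cell p q -> same_cell q s -> same_cell p s.
Proof.
move=> [->//|[N [x [y [NI -> -> xy]]]]] /(chart_same_cell NI)[z yz ->].
by apply: chart_cell => //; right; case: yz => [->|/(deep_trans xy)].
Qed.

(** Depth passes from one coordinate to the other through any apartment of the stage that contains
    [p]. *)
Lemma deep_transition phi psi x u p : compatible phi -> compatible psi ->
  occurs p -> phi x = Some p -> psi u = Some p -> deep x x -> deep u u.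
Proof.
move=> phic psic [M [v [MI ->]]] xp up xx.
have [|w wW [vx _]] := phic _ _ _ MI xp; first by left.
have vv : deep v v by rewrite vx; apply: deep_lin.
have [|w' w'W [vu _]] := psic _ _ _ MI up; first by right.
by apply: (deep_lin_inv w'W); rewrite -vu.
Qed.

(** On a deep cell, the linear map into a common apartment is followed by the inverse of the other
    one. A shallow cell is a single point, so any affine map with the right value there will do. *)
Lemma transition phi psi x u p : compatible phi -> compatible psi ->
  occurs p -> phi x = Some p -> psi u = Some p ->
  exists w, [/\ aff w, w x = u, (deep x x -> lin w) &
                forall y, cell x y -> phi y = psi (w y)].
Proof.
move=> phic psic pI xp up; case: (pselect (deep x x)) => xx; last first.
  have [w wA wx] := aff_trans x u; exists w; split=> // y [->|/deep_refl//].
  by rewrite wx xp.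
have uu := deep_transition phic psic pI xp up xx.
case: pI xp up => M [v [MI ->]] xp up.
have [|w wW [vx wE]] := phic _ _ _ MI xp; first by left.
have [|w' w'W [vu w'E]] := psic _ _ _ MI up; first by left.
have [w2 w2W [w'K Kw']] := lin_inv w'W.
have WW : lin (w2 \o w) by apply: lin_comp.
have Wx : (w2 \o w) x = u by rewrite /= -vx vu Kw'.
exists (w2 \o w); split=> //; first exact: lin_aff.
move=> y /cell_deepl/(_ xx) xy; rewrite wE // w'E /= ?w'K //.
by rewrite -Wx; apply: (deep_lin WW).
Qed.

(** Cells are equivalence classes, so two points of [U] in different cells determine both cells of
    the request. *)
Lemma request_pair U p q : request U -> U p -> U q -> ~ same_cell p q ->
  U = [set s | same_cell p s \/ same_cell q s].
Proof.
move=> [p0 [q0 [_ _ _ ->]]] /=.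
have T a b c : same_cell a b -> same_cell a c -> same_cell b c.
  by move=> /same_cell_sym; apply: same_cell_trans.
have E a b : same_cell a b -> same_cell a = same_cell b.
  move=> ab; apply/predeqP => s; split; first exact: T.
  exact: same_cell_trans ab.
move=> [pp|pp] [qq|qq] npq; try by case: npq; apply: T pp qq.
  by rewrite (E _ _ pp) (E _ _ qq).
by rewrite (E _ _ pp) (E _ _ qq); apply/predeqP => s /=; split=> -[];
  by [left|right].
Qed.

(* A deep point keeps its coordinate up to [r]; the others are sent to [e]
   or [o], so that the two cells become disjoint in the new apartment. *)
Lemma placement x1 x2 : exists a1 a2 w1 w2,
  [/\ [/\ aff w1, w1 a1 = x1, deep x1 x1 ->
    lin w1 & (deep a1 a1 /\ deep x1 x1) \/ (a1 = o \/ a1 = e)],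
      [/\ aff w2, w2 a2 = x2, deep x2 x2 ->
        lin w2 & (deep a2 a2 /\ deep x2 x2) \/ (a2 = o \/ a2 = e)] &
      forall y, cell a1 y -> cell a2 y -> False].
Proof.
have disj a1 a2 : a1 <> a2 -> ~ deep a1 a2 ->
    forall y, cell a1 y -> cell a2 y -> False.
  move=> ne nd y [->|h1] [|h2] //.
  - by apply: nd; apply: deep_sym.
  - by move=> E; apply: nd; rewrite -E.
  - by apply: nd; apply: deep_trans h1 (deep_sym h2).
have [w1e w1eA w1eE] := aff_trans e x1; have [w2o w2oA w2oE] := aff_trans o x2.
have idA := lin_aff lin_id.
case: (pselect (deep x1 x1)) => xx1; case: (pselect (deep x2 x2)) => xx2.
- case: (pselect (deep x1 x2)) => x12.
    have [r' r'W [rK Kr]] := lin_inv r_lin.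
    have nd : ~ deep x1 (r x2) by apply: deep_r.
    exists x1, (r x2), id, r'; split; last first.
    + by apply: disj => // E; apply: nd; rewrite -E.
    + by split=> //; [exact: lin_aff | left; split=> //; apply: deep_lin].
    + by split=> //; left.
  exists x1, x2, id, id; split; [by split=> //; left|by split=> //; left|].
  by apply: disj => // E; apply: x12; rewrite -E.
- exists x1, o, id, w2o; split; [by split=> //; left|by split=> //; right;
  left|].
  by apply: disj => [E|/deep_refr //]; apply: not_deep_o; rewrite -E.
- exists e, x2, w1e, id; split; [by split=> //; right; right|by split=> //;
  left|].
  by apply: disj => [E|/deep_refl //]; apply: not_deep_e; rewrite E.
- exists e, o, w1e, w2o; split; [by split=> //; right; right|by split=> //;
  right; left|].
  by apply: disj => [E|/deep_refl //]; apply: o_neq_e.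
Qed.

Section Placed.
Variables (N : label) (a x : A) (w : A -> A).
Hypotheses (NI : I N) (wA : aff w) (wa : w a = x) (wlin : deep x x -> lin w).
Hypothesis aoe : (deep a a /\ deep x x) \/ (a = o \/ a = e).

Let adeep : deep a a -> deep x x.
Proof. by case: aoe => [[]|[] -> //]. Qed.

(** Here [w] sends coordinates in the new apartment to coordinates in [N]. Since [o] and [e] are
    shallow, [aoe] forces [x] to be deep when [a] is, and then [w] is linear. *)
Lemma placed_cell y : cell a y -> cell x (w y).
Proof.
move=> [->|ay]; first by left; rewrite wa.
by right; rewrite -wa; apply: deep_lin (wlin (adeep (deep_refl ay))) ay.
Qed.

Lemma placed_cell_inv z : cell x z -> exists2 y, cell a y & z = w y.
Proof.
move=> [->|xz]; first by exists a => //; left.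
have wW := wlin (deep_refl xz); have [w' w'W [wK Kw]] := lin_inv wW.
exists (w' z); last by rewrite wK.
by right; apply: (deep_lin_inv wW); rewrite wK wa.
Qed.

(** Depth of [y] or of [u] is first carried to [w y]; the transition from [N] to [M] given by
    coherence is then composed with [w]. *)
Lemma placed_compatible phi M y u : I M ->
  (forall z, cell a z -> phi z = Some (chart N (w z))) ->
  cell a y -> phi y = Some (chart M u) -> deep y y \/ deep u u ->
  exists2 v, lin v & u = v y /\
    forall z, deep y z -> phi z = Some (chart M (v z)).
Proof.
move=> MI phiE ay; rewrite phiE // => -[yu] yyuu.
have xwy := placed_cell ay.
have wylin : deep y y -> deep (w y) (w y).
  by move=> yy; apply: deep_lin => //; apply/wlin/adeep/(cell_deepr ay).
have [||v vW [uv vE]] := (Icoh NI).2 M (w y) u MI _.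
- by rewrite /= yu.
- by case: yyuu => [/wylin|]; [left|right].
have wywy : deep (w y) (w y).
  by case: yyuu => [/wylin //|]; rewrite uv; apply: deep_lin_inv.
have wW := wlin (cell_deepr xwy wywy).
exists (v \o w); first exact: lin_comp.
split=> // z yz; rewrite phiE; last by apply: cell_trans yz.
by have := vE (w z) (deep_lin wW yz).
Qed.

End Placed.

(** The new apartment reaches the cell of [p] through [N1] and that of [q] through [N2]; [placement]
    keeps the two coordinate cells disjoint, so the two halves of [phi] do not clash. *)
Lemma gluing_exists U : request U -> exists phi, gluing U phi.
Proof.
move=> [p [q [[N1 [x1 [N1I pE]]] [N2 [x2 [N2I qE]]] npq UE]]].
have [a1 [a2 [w1 [w2 [[w1A w1a w1l a1oe] [w2A w2a w2l a2oe] disj]]]]] :=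
  placement x1 x2.
pose phi y := if pselect (cell a1 y) then Some (chart N1 (w1 y))
  else if pselect (cell a2 y) then Some (chart N2 (w2 y)) else None.
have phi1 y : cell a1 y -> phi y = Some (chart N1 (w1 y)).
  by rewrite /phi; case: pselect.
have phi2 y : cell a2 y -> phi y = Some (chart N2 (w2 y)).
  move=> a2y; rewrite /phi; case: pselect => [/disj/(_ a2y)//|n1] /=.
  by case: pselect.
have phiP y : phi y <> None -> cell a1 y \/ cell a2 y.
  rewrite /phi; case: pselect => [a1y _|n1] /=; first by left.
  by case: pselect => [a2y _|n2] //=; right.
have same1 y : cell a1 y -> same_cell p (chart N1 (w1 y)).
  by move=> /(placed_cell w1a w1l a1oe) ?; rewrite pE; apply: chart_cell.
have same2 y : cell a2 y -> same_cell q (chart N2 (w2 y)).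
  by move=> /(placed_cell w2a w2l a2oe) ?; rewrite qE; apply: chart_cell.
(* A common point would put [q] in the cell of [p], hence in the apartment [N1], although [p] and
   [q] are not joined. *)
have npq' s : same_cell p s -> same_cell q s -> False.
  move=> ps qs; apply: npq; have [y _ ->] := chart_same_cell N1I
    (eq_ind _ (fun p => same_cell p q) (same_cell_trans ps (same_cell_sym qs)) _
      pE).
  by exists N1, x1, y.
exists phi; split.
- move=> x y s xs ys.
  have [a1x|a2x] : cell a1 x \/ cell a2 x by apply: phiP; rewrite xs.
    have [a1y|a2y] : cell a1 y \/ cell a2 y by apply: phiP; rewrite ys.
      apply: (aff_inj w1A); apply: (Icoh N1I).1.
      by have := ys; rewrite -xs !phi1 // => -[].
    have [] := npq' s; first by have := xs; rewrite phi1 // => -[<-];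
      apply: same1.
    by have := ys; rewrite phi2 // => -[<-]; apply: same2.
  have [a1y|a2y] : cell a1 y \/ cell a2 y by apply: phiP; rewrite ys.
    have [] := npq' s; last by have := xs; rewrite phi2 // => -[<-];
      apply: same2.
    by have := ys; rewrite phi1 // => -[<-]; apply: same1.
  apply: (aff_inj w2A); apply: (Icoh N2I).1.
  by have := ys; rewrite -xs !phi2 // => -[].
- move=> M y u MI yu; have [a1y|a2y] : cell a1 y \/ cell a2 y by apply: phiP;
  rewrite yu.
    exact: (placed_compatible N1I w1a w1l a1oe MI phi1 a1y yu).
  exact: (placed_compatible N2I w2a w2l a2oe MI phi2 a2y yu).
- move=> s; rewrite UE /=; split=> [[ps|qs]|[y ys]].
  + rewrite pE in ps; have [z xz ->] := chart_same_cell N1I ps.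
    by have [y ay ->] := placed_cell_inv w1a w1l xz; exists y; apply: phi1.
  + rewrite qE in qs; have [z xz ->] := chart_same_cell N2I qs.
    by have [y ay ->] := placed_cell_inv w2a w2l xz; exists y; apply: phi2.
  + have [ay|ay] : cell a1 y \/ cell a2 y by apply: phiP; rewrite ys.
      by left; have := ys; rewrite phi1 // => -[<-]; apply: same1.
    by right; have := ys; rewrite phi2 // => -[<-]; apply: same2.
- have H a y : cell a y -> deep a a \/ (a = o \/ a = e) ->
  deep y y \/ (y = o \/ y = e).
    by move=> [->//|ay] _; left; apply: deep_refr ay.
  move=> y /phiP[ay|ay].
    by apply: H ay _; case: a1oe => [[]|]; [left|right].
  by apply: H ay _; case: a2oe => [[]|]; [left|right].
Qed.

Lemma chosen_gluingP U : request U -> gluing U (chosen_gluing U).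
Proof.
move=> /gluing_exists exphi; rewrite /chosen_gluing.
by case: pselect => // h; case: cid.
Qed.

Definition thin := forall N M x y u v, I N -> I M -> N <> M ->
  chart N x = chart M u -> chart N y = chart M v -> cell x y.

Variable k : nat.
Hypothesis Ilevel : forall N, I N -> (level N <= k)%N.
Hypothesis Ipoints : forall p, occurs p -> (level p.1 <= k)%N.
Hypothesis Ithin : thin.

Definition next_stage : set label :=
  [set N | I N \/ exists2 U, request U & N = New k (chosen_gluing U)].

Lemma gluing_occurs U phi x p : request U -> gluing U phi -> phi x = Some p ->
  occurs p.
Proof.
move=> [p0 [q0 [p0I q0I _ UE]]] [_ _ phiU _] xp.
have : U p by apply/phiU; exists x.
by rewrite UE => -[|]; apply: same_cell_occurs.
Qed.

(* Old and new apartments are treated alike: [phi] is the part of the chart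
   that lands in the old points. *)
Lemma next_view N : next_stage N -> exists phi, [/\
  compatible phi,
  (forall x p, phi x = Some p -> occurs p /\ chart N x = p),
  (forall x, phi x = None -> chart N x = (N, x) /\ ~ occurs (N, x)),
  (forall x y p, phi x = Some p -> phi y = Some p -> x = y) &
  (I N /\ phi = Some \o chart N) \/ exists U,
    [/\ request U, gluing U phi & N = New k (chosen_gluing U)]].
Proof.
case=> [NI|[U rU NE]].
  have [Ninj Nc] := Icoh NI; exists (Some \o chart N); split=> //.
  - by move=> x p [<-]; split=> //; exists N, x.
  - by move=> x y p /= [<-] [] /Ninj.
  - by left.
have gU := chosen_gluingP rU; exists (chosen_gluing U); split=> //.
- by case: gU.
- by move=> x p xp; split; [exact: gluing_occurs rU gU xp | rewrite NE /= xp].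
- move=> x xN; split; first by rewrite NE /= xN.
  by move/Ipoints; rewrite NE /= ltnn.
- by case: gU.
- by right; exists U.
Qed.

(** A fresh point carries the label of its apartment and does not occur earlier, so two charts agree
    only at an old point or at the same coordinate of the same apartment. *)
Lemma next_meet N M phi psi x u :
  (forall x p, phi x = Some p -> occurs p /\ chart N x = p) ->
  (forall x, phi x = None -> chart N x = (N, x) /\ ~ occurs (N, x)) ->
  (forall u p, psi u = Some p -> occurs p /\ chart M u = p) ->
  (forall u, psi u = None -> chart M u = (M, u) /\ ~ occurs (M, u)) ->
  chart N x = chart M u ->
  (exists p, [/\ occurs p, phi x = Some p & psi u = Some p]) \/ (N = M /\ x =
    u).
Proof.
move=> phiS phiN psiS psiN.
case xp: (phi x) => [p|]; case uq: (psi u) => [q|].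
- have [pI ->] := phiS _ _ xp; have [_ ->] := psiS _ _ uq.
  by move=> pq; left; exists p; split=> //; rewrite pq.
- have [pI ->] := phiS _ _ xp; have [-> nI] := psiN _ uq.
  by move=> pq; case: nI; rewrite -pq.
- have [-> nI] := phiN _ xp; have [qI ->] := psiS _ _ uq.
  by move=> pq; case: nI; rewrite pq.
- have [-> nI] := phiN _ xp; have [-> _] := psiN _ uq.
  by case=> -> ->; right.
Qed.

(** At a shared old point [transition] compares the two glued parts; a shared fresh point forces the
    two apartments to be equal. *)
Lemma next_coherent N : next_stage N ->
  injective (chart N) /\
  forall M x u, next_stage M -> chart N x = chart M u -> deep x x \/ deep u u ->
    exists2 w, lin w & u = w x /\
      forall y, deep x y -> chart N y = chart M (w y).
Proof.
move=> /next_view[phi [phic phiS phiN phii _]]; split.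
  move=> x y /(next_meet phiS phiN phiS phiN)[[p [_ xp yp]]|[]//].
  exact: phii xp yp.
move=> M x u /next_view[psi [psic psiS psiN _ _]].
move=> /(next_meet phiS phiN psiS psiN)[[p [pI xp up]]|[-> ->] _]; last first.
  by exists id.
move=> xxuu; have xx : deep x x.
  by case: xxuu => //; apply: (deep_transition psic phic pI up xp).
have [w [_ wx /(_ xx) wW wE]] := transition phic psic pI xp up.
exists w => //; split=> // y xy; have xy' : cell x y by right.
have [q yq _] := compatible_cell phic xp pI xy'.
have [_ ->] := phiS _ _ yq.
by have [_ ->] := psiS _ _ (etrans (esym (wE _ xy')) yq).
Qed.

(** Suppose two common points lie in different cells. Old apartments are thin by hypothesis. If
    exactly one apartment is old, it contains both cells of the other's request, which would have
    been joined already. If both are new, their requests coincide, hence so do the apartments. *)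
Lemma next_thin N M x y u v : next_stage N -> next_stage M -> N <> M ->
  chart N x = chart M u -> chart N y = chart M v -> cell x y.
Proof.
move=> /next_view[phi [phic phiS phiN phii phiO]].
move=> /next_view[psi [psic psiS psiN psii psiO]] NM xu yv.
have [[p [pI xp up]]|[]//] := next_meet phiS phiN psiS psiN xu.
have [[q [qI yq vq]]|[]//] := next_meet phiS phiN psiS psiN yv.
suff /(compatible_same_cell phic xp)[y' xy' y'q] : same_cell p q.
  by rewrite (phii _ _ _ yq y'q).
have mixed U f L : I L -> request U -> gluing U f -> U p -> U q ->
    (exists x, chart L x = p) -> (exists y, chart L y = q) -> same_cell p q.
  move=> LI rU _ Up Uq [x' px'] [y' qy']; apply: contrapT => npq.
  have := request_pair rU Up Uq npq; case: rU => p0 [q0 [_ _ nj ->]].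
  move/predeqP => E; apply: nj.
  have p0U := (E p0).1 (or_introl (or_introl erefl)).
  have q0U := (E q0).1 (or_intror (or_introl erefl)).
  have inL s : same_cell p s \/ same_cell q s -> exists z, s = chart L z.
    by rewrite -px' -qy' => -[] /(chart_same_cell LI)[z _ ->]; exists z.
  have [z0 ->] := inL _ p0U; have [z1 ->] := inL _ q0U.
  by exists L, z0, z1.
have UofE U f z s : gluing U f -> f z = Some s -> U s.
  by move=> [_ _ fU _] zs; apply/fU; exists z.
case: phiO => [[NI phiE]|[U [rU gU NE]]].
  case: psiO => [[MI _]|[U' [rU' gU' _]]].
    have := Ithin NI MI NM xu yv => xy.
    have [_ <-] := phiS _ _ xp; have [_ <-] := phiS _ _ yq.
    exact: chart_cell.
  have [U'p U'q] := (UofE _ _ _ _ gU' up, UofE _ _ _ _ gU' vq).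
  apply: (mixed _ _ _ NI rU' gU') => //.
    by exists x; have [] := phiS _ _ xp.
  by exists y; have [] := phiS _ _ yq.
have [Up Uq] := (UofE _ _ _ _ gU xp, UofE _ _ _ _ gU yq).
case: psiO => [[MI _]|[U' [rU' gU' ME]]].
  apply: (mixed _ _ _ MI rU gU) => //.
    by exists u; have [] := psiS _ _ up.
  by exists v; have [] := psiS _ _ vq.
apply: contrapT => npq; apply: NM; rewrite NE ME.
have [U'p U'q] := (UofE _ _ _ _ gU' up, UofE _ _ _ _ gU' vq).
by rewrite (request_pair rU Up Uq npq) (request_pair rU' U'p U'q npq).
Qed.

Lemma next_level N : next_stage N -> (level N <= k.+1)%N.
Proof. by move=> [/Ilevel/leqW|[U _ ->]]. Qed.

Lemma next_points N x : next_stage N -> (level (chart N x).1 <= k.+1)%N.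
Proof.
move=> nN; have [phi [_ phiS phiN _ _]] := next_view nN.
case xp: (phi x) => [p|]; last by have [-> _] := phiN _ xp; apply: next_level.
by have [/Ipoints/leqW + ->] := phiS _ _ xp.
Qed.

Lemma next_join N M x y : I N -> I M -> exists L, next_stage L /\
  (forall z, cell x z -> exists z', chart N z = chart L z') /\
  (forall z, cell y z -> exists z', chart M z = chart L z').
Proof.
move=> NI MI; have NC z := @chart_cell N x z NI;
  have MC z := @chart_cell M y z MI.
case: (pselect (joined (chart N x) (chart M y))) => [[L [x' [y' [LI xx'
  yy']]]]|nj].
  exists L; split; first by left.
  rewrite xx' in NC; rewrite yy' in MC.
  by split=> z; [move/NC|move/MC] => /(chart_same_cell LI)[z' _ ->]; exists z'.
pose U := [set s | same_cell (chart N x) s \/ same_cell (chart M y) s].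
have rU : request U.
  by exists (chart N x), (chart M y); split=> //; [exists N, x | exists M, y].
have [_ _ gU _] := chosen_gluingP rU.
exists (New k (chosen_gluing U)); split; first by right; exists U.
have H s : U s -> exists z', s = chart (New k (chosen_gluing U)) z'.
  by move=> /gU[z' zs]; exists z'; rewrite /= zs.
by split=> z; [move/NC => Ns; apply: H; left|move/MC => Ms; apply: H; right].
Qed.

End Stage.

(** * Iteration from two initial apartments *)

Fixpoint stage (k : nat) : set label :=
  if k is k'.+1 then next_stage (stage k') k' else [set N | exists b,
    N = Base b].

Lemma stage_spec k : [/\ coherent (stage k), thin (stage k),
  forall N, stage k N -> (level N <= k)%N &
  forall p, occurs (stage k) p -> (level p.1 <= k)%N].
Proof.
elim: k => [|k [kc kt kl kp]].
  split=> [N [b ->]|N M x y u v [b ->] [c ->] NM [bc]|N [b ->]|p [N [x [[b ->]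
    ->]]]] //.
    split=> [x y [] //|M x u [c ->] [-> ->] _]; first by exists id.
  by case: NM; rewrite bc.
split.
- move=> N nN; have [Ninj Nc] := next_coherent kc kp nN;
  split=> // M x u nM [xu] d.
  have [w wW [ux wE]] := Nc M x u nM xu d.
  by exists w => //; split=> // y xy; rewrite /= wE.
- by move=> N M x y u v nN nM; apply: (next_thin kc kp kt nN nM).
- by move=> N; apply: next_level.
- by move=> p [N [x [nN ->]]]; apply: (next_points kc kl kp).
Qed.

Lemma stage_le k m N : (k <= m)%N -> stage k N -> stage m N.
Proof.
move=> km kN; elim: m km => [|m IH]; first by rewrite leqn0 => /eqP <-.
by rewrite leq_eqVlt => /orP[/eqP <- //|/IH mN]; left.
Qed.

(* The two initial apartments are disjoint: shallow points of different ones
   are only joined by apartments that place them at [o] and [e]. *)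
Lemma stage_base k L u v x y : stage k L -> ~ deep x x -> ~ deep y y ->
  chart L u = (Base false, x) -> chart L v = (Base true, y) ->
  (u = o /\ v = e) \/ (u = e /\ v = o).
Proof.
move=> + nx ny; elim: k => [[b ->] [-> _] []//|k IH [//|]].
have [kc kt kl kp] := stage_spec k.
have b b' : stage k (Base b') by apply: (@stage_le 0) => //; exists b'.
move=> [U rU ->] /=; have [gi gc gU gd] := chosen_gluingP kc rU.
case up: chosen_gluing => [p|] //= pE; case vq: chosen_gluing => [q|] //= qE.
(* The transition on a deep cell is linear, so a deep [t] would make [s] deep. *)
have H t s b' : chosen_gluing (stage k) U t = Some (Base b', s) -> ~ deep s s ->
  t = o \/ t = e.
  move=> ts ns; have [|tt|//] := gd t; first by rewrite ts.
  have [|w wW [sw _]] := gc (Base b') t s (b b') ts; first by left.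
  by case: ns; rewrite sw; apply: deep_lin.
rewrite {}pE in up; rewrite {}qE in vq.
have hu := H _ _ _ up nx; have hv := H _ _ _ vq ny.
case: hu up => -> up; case: hv vq => -> vq.
- by move: up; rewrite vq.
- by left.
- by right.
- by move: up; rewrite vq.
Qed.

Theorem free_space : exists (X J : Type) (f : J -> A -> X) (i0 i1 : J), [/\
  forall j, injective (f j),
  forall p, exists j x, f j x = p,
  forall i j x u, i <> j -> f i x = f j u ->
    (forall y, (exists v, f i y = f j v) <-> cell x y) /\
    exists2 w, aff w & forall y, cell x y -> f i y = f j (w y),
  forall i j x y, exists k,
    (forall z, cell x z -> exists z', f i z = f k z') /\
    (forall z, cell y z -> exists z', f j z = f k z') &
  forall k u v x y, ~ deep x x -> ~ deep y y -> f k u = f i0 x ->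
    f k v = f i1 y ->
    (u = o /\ v = e) \/ (u = e /\ v = o)].
Proof.
pose J := {N : label | exists k, stage k N}.
pose X := {p : point | exists k, occurs (stage k) p}.
have fP (j : J) x : exists k, occurs (stage k) (chart (sval j) x).
  by case: j => N [k kN]; exists k, N, x.
pose f (j : J) x : X := exist _ _ (fP j x).
have fE i j x u : f i x = f j u <-> chart (sval i) x = chart (sval j) u.
  by split=> [/(congr1 sval)//|E]; apply: eq_exist.
have b0 b : exists k, stage k (Base b) by exists 0%N, b.
have common (i j : J) : exists k, stage k (sval i) /\ stage k (sval j).
  case: i j => N [k kN] [M [m mM]]; exists (maxn k m).
  by split; [apply: stage_le kN; apply: leq_maxl|apply: stage_le mM;
    apply: leq_maxr].
pose mkJ N (h : exists k, stage k N) : J := exist _ N h.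
exists X, J, f, (mkJ _ (b0 false)), (mkJ _ (b0 true)); split.
- case=> N [k kN] x y /fE /=.
  by have [kc _ _ _] := stage_spec k; apply: (kc N kN).1.
- case=> p [k [N [x [kN pE]]]]; exists (mkJ N (ex_intro _ k kN)), x.
  exact: eq_exist.
- move=> i j x u ij /fE xu; have [k [ki kj]] := common i j.
  have [kc kt _ _] := stage_spec k.
  have ne : sval i <> sval j.
    by move=> E; apply: ij; case: (i) (j) E => N NP [M MP] /= E;
      apply: eq_exist.
  have pI : occurs (stage k) (chart (sval j) u) by exists (sval j), u.
  have [w [wA wx _ wE]] := transition (kc _ ki).2 (kc _ kj).2 pI
    (congr1 Some xu : (Some \o chart (sval i)) x = _)
    (erefl : (Some \o chart (sval j)) u = _).
  have fw y : cell x y -> f i y = f j (w y) by move=> /wE [] E; apply/fE.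
  split; last by exists w.
  move=> y; split=> [[v /fE yv]|/fw ->]; last by exists (w y).
  exact: kt ki kj ne xu yv.
- move=> i j x y; have [k [ki kj]] := common i j.
  have [kc _ kl kp] := stage_spec k.
  have [L [nL [Lx Ly]]] := next_join kc k x y ki kj.
  have kL : exists k, stage k L by exists k.+1.
  exists (mkJ L kL); split=> z; [move=> /Lx|move=> /Ly] => -[z' E];
    by exists z'; apply/fE.
- move=> [L [k kL]] u v x y nx ny /fE xu /fE yv.
  exact: stage_base kL nx ny xu yv.
Qed.

End FreeSpace.

(** * Ordered modules and tensor products *)

Section OrderedLmodule.
Variables (K : realType) (F : divringClosed K) (L : orderedLmodType F).
Implicit Types (x y z : L) (a : subfield F).

Lemma olerD2 z x y : (x + z <= y + z) = (x <= y).
Proof.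
by apply/idP/idP => /lmod_lerD2r; [move/(_ (- z)); rewrite !addrK | exact].
Qed.

Lemma oltNge x y : (x < y) = ~~ (y <= x).
Proof.
rewrite lt_def; apply/andP/idP => [[ne xy]|nyx].
  by apply: contra ne => yx; rewrite (@le_anti _ L y x) // xy yx.
have xy : x <= y by case/orP: (lmod_le_total x y) nyx => // ->.
by split=> //; apply: contra nyx => /eqP ->.
Qed.

Lemma oltD2 z x y : (x + z < y + z) = (x < y).
Proof. by rewrite !oltNge olerD2. Qed.

Lemma osubr_ge0 x y : (0 <= y - x) = (x <= y).
Proof. by rewrite -(olerD2 x 0) add0r subrK. Qed.

Lemma olerN2 x y : (- x <= - y) = (y <= x).
Proof. by rewrite -(osubr_ge0 (- x)) opprK addrC osubr_ge0. Qed.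

Lemma olerD x y z t : x <= y -> z <= t -> x + z <= y + t.
Proof.
move=> xy zt; apply: (@le_trans _ _ (y + z)); first by rewrite olerD2.
by rewrite ![y + _]addrC olerD2.
Qed.

Lemma oscale_ge0 a x : 0 <= sfval a -> 0 <= x -> 0 <= a *: x.
Proof.
rewrite le_eqVlt => /orP[/eqP a0|a0] x0; last first.
  by have := lmod_ler_scale a _ _ a0 x0; rewrite scaler0.
suff -> : a = 0 by rewrite scale0r.
by apply: val_inj; rewrite /= -a0.
Qed.

Lemma olt_gt0_double x : (0 < x + x) = (0 < x).
Proof.
apply/idP/idP; rewrite !oltNge; apply: contra => x0.
  by rewrite -[X in _ <= X]addr0 olerD.
case/orP: (lmod_le_total 0 x) => // x0'.
by rewrite (le_trans _ x0) // -[X in X <= _]addr0 olerD.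
Qed.

Lemma odouble_le x y : (x + x <= y + y) = (x <= y).
Proof.
apply/idP/idP => [|xy]; last exact: olerD.
apply: contraTT; rewrite -!oltNge => yx; apply: (@lt_trans _ _ (x + y)).
  by rewrite oltD2.
by rewrite [X in X < _]addrC oltD2.
Qed.

Lemma sfval2 : sfval (2 : subfield F) = 2.
Proof. by rewrite -[sfval _]/(\val (2%:R : subfield F)) rmorph_nat. Qed.

Lemma subfield2_neq0 : (2 : subfield F) != 0.
Proof.
apply/eqP => /(congr1 (@sfval K F))/eqP.
by rewrite sfval2 -[sfval 0]/(0 : K) pnatr_eq0.
Qed.

Lemma ohalf z : exists x, x + x = z.
Proof.
exists (2^-1 *: z); rewrite -scalerDl -[_ + _]mulr2n -[_ *+ _]mulr_natl.
by rewrite mulfV ?subfield2_neq0 // scale1r.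
Qed.

Lemma osumr_ge0 (I : Type) (r : seq I) (P : pred I) (g : I -> L) :
  (forall i, P i -> 0 <= g i) -> 0 <= \sum_(i <- r | P i) g i.
Proof.
move=> g0; elim/big_rec: _ => // i s Pi s0.
by rewrite -[X in X <= _]addr0 olerD // g0.
Qed.

Lemma oler_wpDr x y : 0 <= y -> x <= x + y.
Proof. by move=> y0; rewrite -[X in X <= _]addr0 olerD. Qed.

Lemma oopp_le0 x : (- x <= 0) = (0 <= x).
Proof. by rewrite -[X in _ <= X]oppr0 olerN2. Qed.

Lemma oopp_lt0 x : (- x < 0) = (0 < x).
Proof. by rewrite !oltNge -[X in X <= - x]oppr0 olerN2. Qed.

(** Absolute values are added up; the sum dominates each term because all of them are
    nonnegative. *)
Lemma obounded (T : eqType) (s : seq T) (g : T -> L) :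
  exists2 b, 0 <= b & forall i, i \in s -> - b <= g i /\ g i <= b.
Proof.
elim: s => [|i s [b b0 hb]]; first by exists 0.
have [c [c0 gc]] : exists c, 0 <= c /\ (- c <= g i /\ g i <= c).
  case/orP: (lmod_le_total 0 (g i)) => gi.
    have ng : - g i <= 0 by rewrite oopp_le0.
    by exists (g i); rewrite (le_trans ng gi).
  have ng : 0 <= - g i by rewrite -oopp_le0 opprK.
  by exists (- g i); rewrite opprK (le_trans gi ng).
have cbc : c <= b + c by rewrite addrC oler_wpDr.
have cbb := oler_wpDr b c0.
exists (b + c); first exact: le_trans cbc.
move=> j; rewrite inE => /orP[/eqP ->|/hb]; [case: gc|case] => h1 h2; split.
- by rewrite (le_trans _ h1) // olerN2.
- exact: le_trans cbc.
- by rewrite (le_trans _ h1) // olerN2.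
- exact: le_trans cbb.
Qed.

End OrderedLmodule.

(** * Pure tensors and induced maps *)

Section Tensor.
Local Open Scope quotient_scope.
Variables (F : comNzRingType) (V M : lmodType F).
Implicit Types (x y : tensor V M) (v : V) (m : M).

Lemma tlift_tens (N : lmodType F) (f : {bilinear V -> M -> N}) v m :
  tlift f (tens v m) = f v m.
Proof. by rewrite tlift_pi /teval big_seq1. Qed.

Lemma tensDl v v' m : tens (v + v') m = tens v m + tens v' m.
Proof.
by apply: tensor_ext => N f; rewrite tliftD !tlift_tens linearDl.
Qed.

Lemma tensDr v m m' : tens v (m + m') = tens v m + tens v m'.
Proof.
by apply: tensor_ext => N f; rewrite tliftD !tlift_tens linearDr.
Qed.

Lemma tensZl a v m : tens (a *: v) m = a *: tens v m.
Proof.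
by apply: tensor_ext => N f; rewrite tliftZ !tlift_tens linearZl_LR.
Qed.

Lemma tensZr a v m : tens v (a *: m) = a *: tens v m.
Proof.
by apply: tensor_ext => N f; rewrite tliftZ !tlift_tens linearZr.
Qed.

(** A representative is a finite list of pure tensors, and the induction runs along it. *)
Lemma tensor_ind (P : tensor V M -> Prop) :
  P 0 -> (forall v m x, P x -> P (tens v m + x)) -> forall x, P x.
Proof.
move=> P0 PD x; rewrite -[x]reprK; elim: (repr x) => [//|[v m] s IH].
suff -> : \pi_(tensor V M) ((v, m) :: s) = tens v m + \pi_(tensor V M) s.
  exact: PD.
apply: tensor_ext => N f.
by rewrite tliftD !tlift_tens !tlift_pi /teval big_cons.
Qed.

(** The proof of linearity is part of the term so that a bilinear structure can be attached to it;
    [pairing_fun] follows the same pattern. *)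
Definition tmap_fun (f : V -> V) (_ : linear f) v m := tens (f v) m.

Lemma tmap_fun_bilinear f (fl : linear f) :
  bilinear_for *:%R *:%R (tmap_fun fl).
Proof.
split=> [m a u v|v a m m'] /=.
  by rewrite /tmap_fun fl tensDl tensZl.
by rewrite /tmap_fun tensDr tensZr.
Qed.

HB.instance Definition _ f (fl : linear f) :=
  bilinear_isBilinear.Build F V M (tensor V M) *:%R *:%R (tmap_fun fl)
    (tmap_fun_bilinear fl).

Variable (f : V -> V).
Hypothesis fl : linear f.

Lemma tmapD x y : tmap f (x + y) = tmap f x + tmap f y.
Proof. exact: (tliftD (tmap_fun fl)). Qed.

Lemma tmap0 : tmap f (0 : tensor V M) = 0.
Proof. exact: (tlift0 (tmap_fun fl)). Qed.

Lemma tmap_tens v m : tmap f (tens v m) = tens (f v) m.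
Proof. exact: (tlift_tens (tmap_fun fl)). Qed.

End Tensor.

Lemma tmap_id (F : comNzRingType) (V M : lmodType F) (x : tensor V M) :
  tmap id x = x.
Proof.
have il : linear (@id V) by [].
elim/tensor_ind: x => [|v m x IH]; first by rewrite tmap0.
by rewrite tmapD // tmap_tens // IH.
Qed.

Lemma tmap_comp (F : comNzRingType) (V M : lmodType F) (f g : V -> V)
    (x : tensor V M) : linear f -> linear g ->
  tmap (f \o g) x = tmap f (tmap g x).
Proof.
move=> fl gl.
have cl : linear (f \o g) by move=> a u v /=; rewrite gl fl.
elim/tensor_ind: x => [|v m x IH]; first by rewrite !tmap0.
by rewrite !tmapD // !tmap_tens // IH.
Qed.

(** * Root systems *)

Section Dot.
Variables (K : realType) (n : nat).
Implicit Types (u v w : 'rV[K]_n).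

Lemma dotC u v : dot u v = dot v u.
Proof. by apply: eq_bigr => i _; rewrite mulrC. Qed.

Lemma dot_linearl w : linear ((fun u => dot u w) : 'rV[K]_n -> K^o).
Proof.
move=> a u v; rewrite scaler_sumr -big_split /=; apply: eq_bigr => i _.
by rewrite !mxE mulrDl -mulrA.
Qed.

Lemma dotDl u v w : dot (u + v) w = dot u w + dot v w.
Proof. by have := dot_linearl w 1 u v; rewrite !scale1r. Qed.

Lemma dot0l w : dot 0 w = 0.
Proof. by rewrite /dot big1 // => i _; rewrite mxE mul0r. Qed.

Lemma dotZl a u w : dot (a *: u) w = a * dot u w.
Proof. by have := dot_linearl w a u 0; rewrite addr0 dot0l addr0. Qed.

Lemma dotZr a u w : dot u (a *: w) = a * dot u w.
Proof. by rewrite dotC dotZl dotC. Qed.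

Lemma dotDr u v w : dot w (u + v) = dot w u + dot w v.
Proof. by rewrite dotC dotDl !(dotC w). Qed.

Lemma dot_suml (I : Type) (r : seq I) (g : I -> 'rV[K]_n) w :
  dot (\sum_(i <- r) g i) w = \sum_(i <- r) dot (g i) w.
Proof.
by elim/big_rec2: _ => [|i x y _ <-]; rewrite ?dot0l ?dotDl.
Qed.

Lemma dot_sumr (I : Type) (r : seq I) (g : I -> 'rV[K]_n) w :
  dot w (\sum_(i <- r) g i) = \sum_(i <- r) dot w (g i).
Proof. by rewrite dotC dot_suml; apply: eq_bigr => i _; rewrite dotC. Qed.

Lemma dot_gt0 u : u != 0 -> 0 < dot u u.
Proof.
move=> u0; rewrite lt_def sumr_ge0 ?andbT => [|i _]; last exact: sqr_ge0.
apply: contra u0 => /eqP /psumr_eq0P u0; apply/eqP/rowP => i; rewrite mxE.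
by apply/eqP; rewrite -[_ == 0]orbb -mulf_eq0 u0 // => j _; exact: sqr_ge0.
Qed.

Lemma cpairDl u v w : cpair (u + v) w = cpair u w + cpair v w.
Proof. by rewrite /cpair dotDl mulrDr mulrDl. Qed.

Lemma cpairZl a u w : cpair (a *: u) w = a * cpair u w.
Proof. by rewrite /cpair dotZl !mulrA (mulrC 2). Qed.

Lemma cpair_suml (I : Type) (r : seq I) (g : I -> 'rV[K]_n) w :
  cpair (\sum_(i <- r) g i) w = \sum_(i <- r) cpair (g i) w.
Proof.
by rewrite /cpair dot_suml mulr_sumr mulr_suml.
Qed.

Lemma cpair_self u : u != 0 -> cpair u u = 2.
Proof. by move=> /dot_gt0 u0; rewrite /cpair mulfK // gt_eqF. Qed.

Lemma vec_refl_self u : u != 0 -> vec_refl u u = - u.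
Proof.
move=> u0; rewrite /vec_refl cpair_self // scalerDl scale1r opprD addrA.
by rewrite subrr add0r.
Qed.

Lemma vec_refl_dot a u v : a != 0 ->
  dot (vec_refl a u) v = dot u (vec_refl a v).
Proof.
move=> a0; rewrite /vec_refl -!scaleNr dotDl dotDr dotZl dotZr /cpair.
by rewrite (dotC a v) mulNr mulNr; congr (_ - _); ring.
Qed.

Lemma vec_refl_linear (a : 'rV[K]_n) : linear (vec_refl a).
Proof.
move=> c u v; rewrite /vec_refl cpairDl cpairZl scalerDl scalerDr -!scaleNr.
by rewrite -!scalerA !scaleNr scalerN opprD; rewrite [LHS]addrACA -?scalerA.
Qed.

Lemma vec_reflK a u : a != 0 -> vec_refl a (vec_refl a u) = u.
Proof.
move=> a0; rewrite {2}/vec_refl -scaleNr addrC vec_refl_linear vec_refl_self //.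
by rewrite /vec_refl scalerN scaleNr opprK addrCA subrr addr0.
Qed.

Lemma cpair_vec_refl a u v :
  a != 0 -> cpair (vec_refl a u) v = cpair u (vec_refl a v).
Proof.
by move=> a0; rewrite /cpair vec_refl_dot // [dot (vec_refl a v) _]vec_refl_dot
  // vec_reflK.
Qed.

Lemma cpairNr u v : cpair u (- v) = - cpair u v.
Proof.
by rewrite /cpair -!scaleN1r !dotZr dotZl !mulN1r opprK mulrN mulNr.
Qed.

End Dot.

Section RootSystem.
Variables (K : realType) (n : nat) (Phi : seq 'rV[K]_n).
Hypothesis PhiP : is_root_system Phi.
Variable F : divringClosed K.
Hypothesis PhiF :
  forall a b : 'rV[K]_n, a \in Phi -> b \in Phi -> cpair b a \in F.
Variable L : orderedLmodType F.
Implicit Types (a b : 'rV[K]_n) (u v : rspan F Phi) (x y : model Phi L).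

Lemma root_neq0 a : a \in Phi -> a != 0.
Proof. by case: PhiP => P0 _ _; apply: contraTneq => ->. Qed.

Lemma refl_root a b : a \in Phi -> b \in Phi -> vec_refl a b \in Phi.
Proof. by case: PhiP => _ + _; apply. Qed.

Lemma opp_root a : a \in Phi -> - a \in Phi.
Proof. by move=> aP; rewrite -vec_refl_self ?root_neq0 ?refl_root. Qed.

Lemma in_span_root a : a \in Phi -> a \in in_span F Phi.
Proof.
move=> aP; apply/asboolP.
(* [Phi] may list a root several times, so the coefficient is the inverse of the multiplicity. *)
exists (fun b => if b == a then (count_mem a Phi)%:R^-1 else 0).
have c0 : (count_mem a Phi)%:R != 0 :> K.
  by rewrite pnatr_eq0 -lt0n -has_count; apply/hasP; exists a => /=.
have E b :
    sfval (if b == a then (count_mem a Phi)%:R^-1 else 0 : subfield F) *: b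
    = if b == a then (count_mem a Phi)%:R^-1 *: a else 0.
  case: eqP => [->|_]; last by rewrite scale0r.
  by congr (_ *: _); rewrite -[sfval _]/(\val _) fmorphV rmorph_nat.
under eq_bigr do rewrite E.
rewrite -big_mkcond big_const_seq iter_addr_0 -scaler_nat scalerA.
by rewrite -[count _ _]/(count_mem a Phi) mulfV // scale1r.
Qed.

Lemma cpair_in_span (v : 'rV[K]_n) a :
  v \in in_span F Phi -> a \in Phi -> cpair v a \in F.
Proof.
move=> /asboolP[c ->] aP; rewrite cpair_suml big_seq rpred_sum // => b bP.
by rewrite cpairZl rpredM // ?sfvalP // PhiF.
Qed.

Definition root_vec a (aP : a \in Phi) : rspan F Phi := Rspan (in_span_root aP).

Lemma coroot_val a v : a \in Phi -> sfval (coroot a v) = cpair (rspan_val v) a.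
Proof. by move=> aP; rewrite [LHS]insubdK //; apply: cpair_in_span aP;
  apply: rspanP. Qed.

Lemma coroot_linear a : a \in Phi ->
  linear (coroot a : rspan F Phi -> (subfield F)^o).
Proof.
move=> aP c u v; apply: val_inj; rewrite /= !coroot_val //=.
by rewrite cpairDl cpairZl.
Qed.

Lemma span_reflE a v (aP : a \in Phi) :
  span_refl a v = v - coroot a v *: root_vec aP.
Proof.
have E : vec_refl a (rspan_val v) = rspan_val (v - coroot a v *: root_vec aP).
  by rewrite /= coroot_val.
by apply: val_inj; rewrite /span_refl E [LHS]insubdK ?rspanP.
Qed.

Lemma span_refl_val a v :
  a \in Phi -> rspan_val (span_refl a v) = vec_refl a (rspan_val v).
Proof. by move=> aP; rewrite span_reflE /= coroot_val. Qed.

Lemma span_refl_linear a : a \in Phi -> linear (@span_refl K n F Phi a).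
Proof.
move=> aP c u v; apply: val_inj.
by rewrite /= !span_refl_val //= vec_refl_linear.
Qed.

Lemma weyl_linear w : @weyl K n F Phi w -> linear w.
Proof.
by elim=> [|a w' aP _ wl] // c u v /=; rewrite wl span_refl_linear.
Qed.

Lemma span_reflK a v : a \in Phi -> span_refl a (span_refl a v) = v.
Proof.
by move=> aP; apply: val_inj; rewrite /= !span_refl_val // vec_reflK ?root_neq0.
Qed.

Lemma weyl_comp w w' : @weyl K n F Phi w -> @weyl K n F Phi w' ->
  weyl (w \o w').
Proof. by elim=> [|a w1 aP _ IH] // wP; apply: (weyl_refl aP); apply: IH. Qed.

Lemma weyl_inv w : @weyl K n F Phi w ->
  exists2 w', @weyl K n F Phi w' &
    (forall v, w (w' v) = v) /\ (forall v, w' (w v) = v).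
Proof.
elim=> [|a w1 aP _ [w' wP [w1K wK1]]]; first by exists id => //; apply: weyl_id.
exists (w' \o (@span_refl K n F Phi a \o id)).
  by apply: weyl_comp => //; apply: weyl_refl => //; apply: weyl_id.
by split=> v /=; rewrite ?w1K ?span_reflK // wK1.
Qed.

Definition pairing_fun a (_ : a \in Phi) v (l : L) : L := coroot a v *: l.

Lemma pairing_fun_bilinear a (aP : a \in Phi) :
  bilinear_for *:%R *:%R (pairing_fun aP).
Proof.
split=> [l c u v|v c l l'] /=; rewrite /pairing_fun.
  by rewrite coroot_linear // scalerDl -scalerA.
by rewrite scalerDr !scalerA mulrC.
Qed.

HB.instance Definition _ a (aP : a \in Phi) :=
  bilinear_isBilinear.Build (subfield F) (rspan F Phi) L L *:%R *:%R
    (pairing_fun aP)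
    (pairing_fun_bilinear aP).

Lemma pairingD a x y : a \in Phi ->
  pairing a (x + y) = pairing a x + pairing a y.
Proof. by move=> aP; apply: (tliftD (pairing_fun aP)). Qed.

Lemma pairing0 a : a \in Phi -> pairing a (0 : model Phi L) = 0.
Proof. by move=> aP; apply: (tlift0 (pairing_fun aP)). Qed.

Lemma pairingN a x : a \in Phi -> pairing a (- x) = - pairing a x.
Proof.
by move=> aP; apply/eqP; rewrite -addr_eq0 -pairingD // addNr pairing0.
Qed.

Lemma pairingB a x y : a \in Phi ->
  pairing a (x - y) = pairing a x - pairing a y.
Proof. by move=> aP; rewrite pairingD // pairingN. Qed.

Lemma pairing_tens a v l :
  a \in Phi -> pairing a (tens v l : model Phi L) = coroot a v *: l.
Proof. by move=> aP; apply: (tlift_tens (pairing_fun aP)). Qed.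

Lemma pairing_Nroot a x : a \in Phi -> pairing (- a) x = - pairing a x.
Proof.
move=> aP; have NP := opp_root aP.
elim/tensor_ind: x => [|v l x IH]; first by rewrite !pairing0 ?oppr0.
rewrite !pairingD // !pairing_tens // IH opprD -scaleNr; congr (_ *: _ + _).
by apply: val_inj; rewrite /= !coroot_val // cpairNr.
Qed.

Lemma pairing_refl a b x : a \in Phi -> b \in Phi ->
  pairing a (tmap (@span_refl K n F Phi b) x) = pairing (vec_refl b a) x.
Proof.
move=> aP bP; have rP := refl_root bP aP; have sl := span_refl_linear bP.
elim/tensor_ind: x => [|v l x IH]; first by rewrite tmap0 // !pairing0.
rewrite tmapD // !pairingD // tmap_tens // !pairing_tens // IH.
congr (_ *: _ + _); apply: val_inj.
by rewrite /= !coroot_val // span_refl_val // cpair_vec_refl // root_neq0.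
Qed.

Lemma pairing_refl_self a x : a \in Phi ->
  pairing a (tmap (@span_refl K n F Phi a) x) = - pairing a x.
Proof.
by move=> aP; rewrite pairing_refl // vec_refl_self ?root_neq0 // pairing_Nroot.
Qed.

(** Reflections are self-adjoint up to scaling of roots, so each one moves from the point to the
    root, and roots are permuted. *)
Lemma weyl_root w a : @weyl K n F Phi w -> a \in Phi ->
  exists2 b, b \in Phi & forall x, pairing a (tmap w x) = pairing b x.
Proof.
move=> wP; elim: wP a => [|c w' cP w'P IH] a aP.
  by exists a => // x; rewrite tmap_id.
have [b bP bE] := IH _ (refl_root cP aP).
exists b => // x; rewrite tmap_comp ?pairing_refl ?bE //.
  exact: span_refl_linear.
exact: weyl_linear.
Qed.

End RootSystem.

(** * Simple roots and their dual basis *)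

Section Basis.
Variables (K : realType) (n : nat) (Phi : seq 'rV[K]_n).
Hypothesis PhiP : is_root_system Phi.
Variable F : divringClosed K.
Hypothesis PhiF :
  forall a b : 'rV[K]_n, a \in Phi -> b \in Phi -> cpair b a \in F.
Variable B : 'I_n -> 'rV[K]_n.
Hypothesis BP : is_basis Phi B.
Variable L : orderedLmodType F.
Implicit Types (a b : 'rV[K]_n) (u v : rspan F Phi) (x y : model Phi L).

Let corootl a (aP : a \in Phi) := coroot_linear PhiF aP.

Lemma basis_root i : B i \in Phi.
Proof. by case: BP. Qed.

Lemma basis_span (v : 'rV[K]_n) : exists c : 'I_n -> K, v = \sum_i c i *: B i.
Proof.
case: BP => _; set M := \matrix_i B i; rewrite row_free_unit => Mu _.
exists (fun i => (v *m invmx M) 0 i); rewrite -[LHS](mulmxKV Mu) mulmx_sum_row.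
by apply: eq_bigr => i _; rewrite rowK.
Qed.

Lemma basis_free (c : 'I_n -> K) : \sum_i c i *: B i = 0 -> forall i, c i = 0.
Proof.
case: BP => _ Bf _ c0 i.
have /(row_free_inj Bf) : (\row_j c j) *m \matrix_i B i = 0 *m \matrix_i B i.
  rewrite mul0mx mulmx_sum_row -[RHS]c0; apply: eq_bigr => j _.
  by rewrite rowK mxE.
by move/rowP/(_ i); rewrite !mxE.
Qed.

Lemma cpair_basis_eq0 (v : 'rV[K]_n) : (forall i, cpair v (B i) = 0) -> v = 0.
Proof.
move=> v0; apply/eqP; apply: contraT => /dot_gt0;
  rewrite lt_def => /andP[/eqP[]].
have [c {2}->] := basis_span v; rewrite dot_sumr big1 // => i _.
have := v0 i; rewrite dotZr /cpair => /eqP.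
have /dot_gt0/gt_eqF B0 := root_neq0 PhiP (basis_root i).
by rewrite !mulf_eq0 invr_eq0 B0 pnatr_eq0 orbF /= => /eqP ->; rewrite mulr0.
Qed.

Definition cartan : 'M[subfield F]_n :=
  \matrix_(i, j) coroot (B j) (root_vec F (basis_root i)).

(** A row vector in the kernel gives a combination of simple roots orthogonal to all of them, hence
    zero. The inverse has entries in [F], which keeps the dual basis inside the [F]-span. *)
Lemma cartan_unit : cartan \in unitmx.
Proof.
rewrite -row_free_unit -kermx_eq0; apply/eqP/row_matrixP => i.
rewrite row0; set c := row i _.
have cA : c *m cartan = 0 by rewrite -row_mul mulmx_ker row0.
have v0 : \sum_j sfval (c 0 j) *: B j = 0.
  apply: cpair_basis_eq0 => k; rewrite cpair_suml.
  have /rowP/(_ k) := cA; rewrite !mxE => /(congr1 (@sfval K F)).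
  rewrite -[sfval _]/(\val _) rmorph_sum /= => E; rewrite -[RHS]E.
  apply: eq_bigr => j _; rewrite cpairZl [cartan _ _]mxE /=.
  by rewrite (coroot_val PhiF) ?basis_root.
by apply/rowP => j; apply: val_inj; rewrite [in RHS]mxE; apply: (basis_free v0).
Qed.

(** The basis dual to the simple coroots, obtained from the inverse Cartan matrix. *)
Definition coweight (j : 'I_n) : rspan F Phi :=
  \sum_i invmx cartan j i *: root_vec F (basis_root i).

Lemma coroot_sum a (I : Type) (r : seq I) (g : I -> rspan F Phi) : a \in Phi ->
  coroot a (\sum_(i <- r) g i) = \sum_(i <- r) coroot a (g i).
Proof.
move=> aP; elim/big_rec2: _ => [|i u v _ <-].
  by have := corootl aP (-1) 0 0; rewrite scaler0 addr0 scaleN1r addNr.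
by have := corootl aP 1 (g i) v; rewrite !scale1r.
Qed.

Lemma corootZ a c u : a \in Phi -> coroot a (c *: u) = c * coroot a u.
Proof.
move=> aP; have := corootl aP c u 0.
have := corootl aP (-1) 0 0; rewrite scaler0 addr0 scaleN1r addNr => ->.
by rewrite !addr0.
Qed.

Lemma corootB a u v : a \in Phi -> coroot a (u - v) = coroot a u - coroot a v.
Proof.
move=> aP; have := corootl aP (-1) v u; rewrite !scaleN1r.
by rewrite [X in coroot a X = _]addrC [RHS]addrC.
Qed.

Lemma coroot_coweight i j : coroot (B i) (coweight j) = (j == i)%:R.
Proof.
have := mulVmx cartan_unit => /matrixP/(_ j i).
rewrite !mxE => <-; rewrite coroot_sum ?basis_root //.
by apply: eq_bigr => k _; rewrite corootZ ?basis_root // mxE.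
Qed.

Lemma coroot_basis_inj u v :
  (forall i, coroot (B i) u = coroot (B i) v) -> u = v.
Proof.
move=> uv; apply/eqP; rewrite -subr_eq0; apply/eqP/val_inj => /=.
apply: cpair_basis_eq0 => i; have BiP := basis_root i.
by rewrite -(coroot_val PhiF (u - v) BiP) corootB // uv subrr.
Qed.

Lemma coweight_decomp u : u = \sum_j coroot (B j) u *: coweight j.
Proof.
apply: coroot_basis_inj => i; have BiP := basis_root i.
rewrite coroot_sum // (bigD1 i) //= corootZ // coroot_coweight eqxx mulr1.
rewrite big1 ?addr0 // => j ji.
by rewrite corootZ // coroot_coweight (negPf ji) mulr0.
Qed.

(** Pairings with the simple roots are coordinates: expand the left factor of a pure tensor in the
    dual basis and move the scalars to the right factor. *)
Lemma model_decomp x : x = \sum_j tens (coweight j) (pairing (B j) x) :> model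
  Phi L.
Proof.
elim/tensor_ind: x => [|v l x IH].
  rewrite big1 // => j _; rewrite pairing0 ?basis_root //.
  by have := tensDr (coweight j) (0 : L) 0; rewrite addr0 -[LHS]addr0 => /addrI.
rewrite {1}IH {1}(coweight_decomp v).
have -> : tens (\sum_j coroot (B j) v *: coweight j) l =
    \sum_j tens (coweight j) (coroot (B j) v *: l) :> model Phi L.
  elim/big_rec2: _ => [|j u y _ <-].
    by have := tensDl (0 : rspan F Phi) 0 l;
      rewrite addr0 -[LHS]addr0 => /addrI.
  by rewrite tensDl tensZl tensZr.
rewrite -big_split; apply: eq_bigr => j _ /=.
by rewrite pairingD ?basis_root // pairing_tens ?basis_root // tensDr.
Qed.

Lemma pairing_basis_inj x y :
  (forall i, pairing (B i) x = pairing (B i) y) -> x = y.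
Proof.
by move=> xy; rewrite (model_decomp x) (model_decomp y); apply: eq_bigr => i _;
  rewrite xy.
Qed.

Lemma pairing_sum a (I : Type) (r : seq I) (g : I -> model Phi L) : a \in Phi ->
  pairing a (\sum_(i <- r) g i) = \sum_(i <- r) pairing a (g i).
Proof.
by move=> aP; elim/big_rec2: _ => [|i u v _ <-]; rewrite ?pairing0 ?pairingD.
Qed.

Lemma pairing_decomp a x : a \in Phi ->
  pairing a x = \sum_j coroot a (coweight j) *: pairing (B j) x.
Proof.
move=> aP; rewrite {1}(model_decomp x) pairing_sum //.
by apply: eq_bigr => j _; rewrite pairing_tens.
Qed.

(** The value at the [j]-th dual vector is the [j]-th coefficient of [a] in the basis, times the
    positive ratio of the squared lengths of [B j] and [a]. *)
Lemma coroot_coweight_sign a : a \in Phi ->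
  (forall j, 0 <= sfval (coroot a (coweight j))) \/
  (forall j, sfval (coroot a (coweight j)) <= 0).
Proof.
move=> aP; case: BP => _ _ /(_ _ aP)[c ac cs].
have E j : sfval (coroot a (coweight j)) =
    c j * (dot (B j) (B j) / dot a a).
  rewrite (coroot_val PhiF) // /cpair {1}ac dot_sumr (bigD1 j) //=.
  have H i : 2 * dot (rspan_val (coweight j)) (B i) =
      (j == i)%:R * dot (B i) (B i).
    have /(congr1 (@sfval K F)) := coroot_coweight i j;
      rewrite (coroot_val PhiF) ?basis_root //.
    have /dot_gt0/gt_eqF/negbT B0 := root_neq0 PhiP (basis_root i).
    rewrite /cpair => /(congr1 (fun z => z * dot (B i) (B i))).
    rewrite divfK // => ->; congr (_ * _).
    by rewrite -[sfval _]/(\val _) rmorph_nat.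
  rewrite big1 ?addr0 => [|i ij].
    by rewrite dotZr mulrCA H eqxx mul1r mulrA.
  have /eqP := H i; rewrite (eq_sym j) (negPf ij) mul0r mulf_eq0 pnatr_eq0 /=.
  by rewrite dotZr => /eqP ->; rewrite mulr0.
have q0 j : 0 <= dot (B j) (B j) / dot a a.
  by rewrite divr_ge0 // ltW // dot_gt0 // (root_neq0 PhiP) ?basis_root.
case: cs => cs; [left|right] => j; rewrite E.
  exact: mulr_ge0.
exact: mulr_le0_ge0.
Qed.

(** A regular vector of the fundamental chamber: every simple coroot takes the value 1 on it. *)
Definition rho : rspan F Phi := \sum_j coweight j.

(** The values of the coroot on the dual basis have one sign. If their sum vanished, so would each
    of them and hence the whole coroot, which takes the value 2 on [a]. *)
Lemma coroot_rho_neq0 a : a \in Phi -> sfval (coroot a rho) != 0.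
Proof.
move=> aP; apply/eqP; rewrite /rho coroot_sum // -[sfval _]/(\val _) rmorph_sum
  /= => s0.
have c0 j : sfval (coroot a (coweight j)) = 0.
  case: (coroot_coweight_sign aP) => sg; move: s0.
    by move/psumr_eq0P => ->.
  move/(congr1 -%R); rewrite oppr0 -sumrN => /psumr_eq0P s0.
  by apply/eqP; rewrite -oppr_eq0 s0 // => i _; rewrite oppr_ge0.
have : sfval (coroot a (root_vec F aP)) = 2.
  by rewrite (coroot_val PhiF) //= cpair_self // (root_neq0 PhiP).
rewrite (coweight_decomp (root_vec F aP)) coroot_sum // big1 => [/esym/eqP|j _].
  by rewrite -[sfval _]/(0 : K) pnatr_eq0.
by rewrite corootZ //; apply: val_inj; rewrite /= c0 mulr0.
Qed.

End Basis.

(** * Geometry of the model space *)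

Section Geometry.
Variables (K : realType) (n : nat) (Phi : seq 'rV[K]_n).
Hypothesis PhiP : is_root_system Phi.
Variable F : divringClosed K.
Hypothesis PhiF :
  forall a b : 'rV[K]_n, a \in Phi -> b \in Phi -> cpair b a \in F.
Variable B : 'I_n -> 'rV[K]_n.
Hypothesis BP : is_basis Phi B.
Hypothesis n_ge2 : (1 < n)%N.
Variable L : orderedLmodType F.
Variable lam : L.
Hypothesis lam_gt0 : 0 < lam.
Implicit Types (a b : 'rV[K]_n) (x y z s t : model Phi L) (l : L).
Implicit Types (u w : model Phi L -> model Phi L) (D : set (model Phi L)).

Definition linW u : Prop := exists2 w0, @weyl K n F Phi w0 & u = tmap w0.

Lemma linW_id : linW id.
Proof. by exists id; [apply: weyl_id | apply/funext => x; rewrite tmap_id]. Qed.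

Lemma linW_comp u w : linW u -> linW w -> linW (u \o w).
Proof.
case=> u0 u0P -> [w0 w0P ->]; exists (u0 \o w0); first exact: weyl_comp.
by apply/funext => x; rewrite (tmap_comp _ (weyl_linear PhiF u0P) (weyl_linear
  PhiF w0P)).
Qed.

Lemma linW_inv u : linW u -> exists2 w, linW w & cancel w u /\ cancel u w.
Proof.
case=> u0 u0P ->; have [w0 w0P [uK wK]] := weyl_inv PhiP PhiF u0P.
exists (tmap w0); first by exists w0.
have [ul wl] := (weyl_linear PhiF u0P, weyl_linear PhiF w0P).
split=> x; [rewrite -(tmap_comp _ ul wl)|rewrite -(tmap_comp _ wl ul)];
  by rewrite -[RHS]tmap_id; congr (tmap _ x); apply/funext.
Qed.

Lemma linWD u x y : linW u -> u (x + y) = u x + u y.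
Proof. by case=> u0 u0P ->; rewrite tmapD //; apply: (weyl_linear PhiF). Qed.

Lemma linW_root u a : linW u -> a \in Phi ->
  exists2 b, b \in Phi & forall x, pairing a (u x) = pairing b x.
Proof. by case=> u0 u0P ->; apply: weyl_root. Qed.

Lemma linW_refl a : a \in Phi -> linW (tmap (@span_refl K n F Phi a)).
Proof.
by move=> aP; exists (@span_refl K n F Phi a \o id) => //;
  apply: weyl_refl aP _; apply: weyl_id.
Qed.

Lemma affWP w : affW w <-> exists2 u, linW u & exists t, w = fun x => t + u x.
Proof.
split=> [[w0 w0P [t ->]]|[u [w0 w0P ->] [t ->]]].
  by exists (tmap w0); [exists w0 | exists t].
by exists w0 => //; exists t.
Qed.

Lemma affW_lin u : linW u -> affW u.
Proof.
move=> uW; apply/affWP; exists u => //; exists 0.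
by apply/funext => x; rewrite add0r.
Qed.

Lemma affW_id : affW (id : model Phi L -> _).
Proof. exact/affW_lin/linW_id. Qed.

Lemma affW_transl t : affW (fun x => t + x).
Proof. by apply/affWP; exists id; [exact: linW_id | exists t]. Qed.

Lemma affW_comp w w' : affW w -> affW w' -> affW (w \o w').
Proof.
move=> /affWP[u uW [t ->]] /affWP[u' uW' [t' ->]]; apply/affWP.
exists (u \o u'); first exact: linW_comp.
by exists (t + u t'); apply/funext => x /=; rewrite linWD // addrA.
Qed.

Lemma affW_inv w : affW w -> exists2 w', affW w' & cancel w' w /\ cancel w w'.
Proof.
move=> /affWP[u uW [t ->]]; have [u' uW' [uK Ku]] := linW_inv uW.
exists (fun x => u' (- t) + u' x); first by apply/affWP; exists u' => //;
  exists (u' (- t)).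
split=> x; first by rewrite -linWD // uK addrA subrr add0r.
by rewrite -linWD // addKr Ku.
Qed.

Lemma affW_inj w : affW w -> injective w.
Proof. by case/affW_inv=> w' _ [_ /can_inj]. Qed.

Lemma pairing_inj x y :
  (forall a, a \in Phi -> pairing a x = pairing a y) -> x = y.
Proof.
by move=> xy; apply: (pairing_basis_inj PhiP PhiF BP) => i;
  apply/xy/(basis_root BP).
Qed.

Lemma pairing_surj a l : a \in Phi -> exists x, pairing a x = l.
Proof.
move=> aP; exists (tens (root_vec F aP) (2^-1 *: l)).
rewrite pairing_tens // scalerA.
have -> : coroot a (root_vec F aP) = 2.
  by apply: val_inj; rewrite /= (coroot_val PhiF) // cpair_self ?sfval2 //
    (root_neq0 PhiP).
by rewrite mulfV ?subfield2_neq0 // scale1r.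
Qed.

Lemma half_apartmentP D : is_half_apartment D <->
  exists a l, a \in Phi /\ D = [set x | l <= pairing a x].
Proof.
split=> [[a [t [p [aP _ ->]]]]|[a [l [aP ->]]]];
  first by exists a, (pairing a p).
have [p <-] := pairing_surj l aP.
(* This translation part makes [p] a fixed point of the affine reflection. *)
exists a, (p - tmap (@span_refl K n F Phi a) p), p; split=> //.
by rewrite /affine_fix /= subrK.
Qed.

Lemma half_apartment_preim w D :
  affW w -> is_half_apartment D -> is_half_apartment (w @^-1` D).
Proof.
move=> /affWP[u uW [t ->]] /half_apartmentP[a [l [aP ->]]];
  apply/half_apartmentP.
have [b bP bE] := linW_root uW aP.
have E x : (l <= pairing a (t + u x)) = (l - pairing a t <= pairing b x).
  by rewrite (pairingD PhiF) // bE -(olerD2 (pairing a t) (l - _)) subrK addrC.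
by exists b, (l - pairing a t); split=> //; apply/seteqP; split=> x;
  rewrite /= E.
Qed.

Lemma closed_convex_preim w D :
  affW w -> closed_convex D -> closed_convex (w @^-1` D).
Proof.
move=> wW [m [E [EP ->]]]; exists m, (fun i => w @^-1` E i); split=> // i.
exact: half_apartment_preim.
Qed.

Lemma closed_convexT : closed_convex [set: model Phi L].
Proof.
exists 0%N, (fun=> setT); split; first by case.
by apply/seteqP; split.
Qed.

Definition deep x y : Prop := forall a, a \in Phi ->
  (lam <= pairing a x /\ lam <= pairing a y) \/
  (pairing a x <= - lam /\ pairing a y <= - lam).

Local Notation cell := (cell deep).

Lemma lamN : (lam <= - lam) = false.
Proof.
apply/negbTE; rewrite -oltNge -(oltD2 lam) addNr.
by rewrite olt_gt0_double.
Qed.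

Lemma deep_sym x y : deep x y -> deep y x.
Proof. by move=> xy a /xy[[]|[]]; [left|right]. Qed.

Lemma deep_trans y x z : deep x y -> deep y z -> deep x z.
Proof.
move=> xy yz a aP; have [[h1 h2]|[h1 h2]] := xy a aP.
  by have [[h3 h4]|[h3 h4]] := yz a aP; [left | have := le_trans h2 h3;
    rewrite lamN].
have [[h3 h4]|[h3 h4]] := yz a aP; last by right.
by have := le_trans h3 h2; rewrite lamN.
Qed.

Lemma deep_refl x y : deep x y -> deep x x.
Proof. by move=> xy; apply: deep_trans xy (deep_sym xy). Qed.

Lemma deep_linW u x y : linW u -> deep x y -> deep (u x) (u y).
Proof. by move=> uW xy a aP; have [b bP bE] := linW_root uW aP; rewrite !bE;
  apply: xy. Qed.

Let i0 : 'I_n := Ordinal (ltnW n_ge2).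
Let i1 : 'I_n := Ordinal n_ge2.

Lemma not_deep a x : a \in Phi -> - lam < pairing a x -> pairing a x < lam ->
  ~ deep x x.
Proof.
by move=> aP h1 h2 /(_ a aP)[[h _]|[h _]]; [move: h2|move: h1];
  rewrite oltNge h.
Qed.

Lemma not_deep0 : ~ deep 0 0.
Proof.
have aP := basis_root BP i0; apply: (not_deep aP); rewrite (pairing0 PhiF) //.
by rewrite oopp_lt0.
Qed.

Definition refl0 : model Phi L -> model Phi L :=
  tmap (@span_refl K n F Phi (B i0)).

Lemma refl0W : linW refl0.
Proof. exact/linW_refl/basis_root. Qed.

Lemma deep_refl0 x y : deep x y -> ~ deep x (refl0 y).
Proof.
move=> xy xry; have aP := basis_root BP i0.
have /(_ _ aP) := deep_trans (deep_sym xy) xry.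
rewrite (pairing_refl_self PhiP PhiF) //; case=> -[h1].
  by rewrite -olerN2 opprK => /(le_trans h1); rewrite lamN.
by rewrite -olerN2 !opprK => /le_trans/(_ h1); rewrite lamN.
Qed.

(** A deep cell is cut out by one half-apartment per root, on the side of [x]. For a shallow [x],
    the inequalities for [a] and [- a] together force equality of all pairings, leaving only [x]. *)
Lemma cell_closed_convex x : closed_convex (cell x).
Proof.
pose D (i : 'I_(size Phi)) : set (model Phi L) := let a := nth 0 Phi i in
  if pselect (deep x x) then
    if lam <= pairing a x then [set y | lam <= pairing a y]
    else [set y | lam <= pairing (- a) y]
  else [set y | pairing a x <= pairing a y].
exists (size Phi), D; split=> [i|].
  have aP := mem_nth 0 (ltn_ord i); rewrite /D; apply/half_apartmentP.
  case: pselect => _ /=; last by exists (nth 0 Phi i),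
    (pairing (nth 0 Phi i) x).
  case: ifP => _; first by exists (nth 0 Phi i), lam.
  by exists (- nth 0 Phi i), lam; split=> //; apply: opp_root.
have DE y : (forall i, D i y) <-> forall a, a \in Phi ->
    if pselect (deep x x) then
      if lam <= pairing a x then lam <= pairing a y else lam <= pairing (- a) y
    else pairing a x <= pairing a y.
  split=> [Dy a aP|h i].
    have iP : (index a Phi < size Phi)%N by rewrite index_mem.
    have := Dy (Ordinal iP); rewrite /D /= nth_index //.
    by case: pselect => //= _; case: ifP.
  by have := h _ (mem_nth 0 (ltn_ord i)); rewrite /D; case: pselect => //= _;
    case: ifP.
apply/seteqP; split=> y; last move/DE; rewrite /=.
  move=> xy; apply/DE => a aP; case: pselect => /= xx.
    have {}xy : deep x y by case: xy => // ->.
    have [[-> ->]//|[h1 h2]] := xy a aP.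
    case: ifP => [/le_trans/(_ h1)|_]; first by rewrite lamN.
    by rewrite (pairing_Nroot PhiP PhiF) // -olerN2 opprK.
  by case: xy => [->//|/deep_refl].
case: pselect => /= xx h; [right=> a aP|left].
  have := h a aP; have [[h1 _]|[h1 _]] := xx a aP; first by rewrite h1; left.
  case: ifP => [h2|_]; first by have := le_trans h2 h1; rewrite lamN.
  rewrite (pairing_Nroot PhiP PhiF) // -olerN2 opprK; by right.
apply/pairing_inj => a aP; apply/eqP; rewrite eq_le h // andbT.
by rewrite -olerN2 -!(pairing_Nroot PhiP PhiF) // h // opp_root.
Qed.

(* Moving along a direction killed by the root of D leaves every cell. *)
Lemma half_apartment_not_cell D x : is_half_apartment D -> ~ D `<=` cell x.
Proof.
move=> /half_apartmentP[b [l [bP ->]]] Dx.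
have [p pl] := pairing_surj l bP.
have B0 := basis_root BP i0; have B1 := basis_root BP i1.
pose cw := coweight F BP.
have [v [bv [a aP av]]] : exists v : rspan F Phi, coroot b v = 0 /\
    exists2 a, a \in Phi & coroot a v != 0.
  have H c d i : i \in [:: i0; i1] -> coroot (B i) (c *: cw i0 - d *: cw i1) =
     if i == i0 then c else - d.
    move=> ii; have BiP := basis_root BP i.
    rewrite (corootB PhiF) // !(corootZ PhiF) // !(coroot_coweight PhiP PhiF).
    move: ii; rewrite !inE => /orP[]/eqP ->.
      by rewrite eqxx mulr1 mulr0 subr0.
    by rewrite mulr0 eqxx mulr1 sub0r.
  (* Rank at least 2 leaves a nonzero combination of two dual basis vectors on which the coroot of
     [b] vanishes; [B i0] or [B i1] detects it. *)
  have [c0|c0] := eqVneq (coroot b (cw i0)) 0.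
    exists (cw i0); split=> //; exists (B i0) => //.
    by rewrite (coroot_coweight PhiP PhiF) eqxx oner_eq0.
  exists (coroot b (cw i1) *: cw i0 - coroot b (cw i0) *: cw i1); split.
    by rewrite (corootB PhiF) // !(corootZ PhiF) // mulrC subrr.
  by exists (B i1) => //; rewrite H ?inE ?eqxx ?orbT //= oppr_eq0.
pose q m : model Phi L := p + tens v m.
have qx m : cell x (q m).
  apply: Dx; rewrite /= /q (pairingD PhiF) // (pairing_tens PhiF) // bv scale0r
    addr0 pl.
  exact: lexx.
have qa m : exists m', pairing a (q m') = m.
  exists ((coroot a v)^-1 *: (m - pairing a p)).
  rewrite /q (pairingD PhiF) // (pairing_tens PhiF) // scalerA mulfV // scale1r.
  by rewrite addrC subrK.
have nd m : ~ deep x (q m) -> q m = x by case: (qx m).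
(* The point of the line with value 0 is shallow, so it must be [x]. The cell is then a single
   point, yet it also contains the point with value [lam]. *)
have [m m0] := qa 0; have [m' ml] := qa lam.
have d0 : ~ deep (q m) (q m).
  apply: (not_deep aP); rewrite m0 //.
  by rewrite oopp_lt0.
have qmx : q m = x by apply: nd => /deep_sym/deep_refl.
have : q m' = x by apply: nd; rewrite -qmx => /deep_refl.
move/(congr1 (pairing a)); rewrite ml -qmx m0 => l0.
by move: lam_gt0; rewrite l0 ltxx.
Qed.

End Geometry.

(** * Deep sub-chambers and small distances *)

Section Metric.
Variables (K : realType) (n : nat) (Phi : seq 'rV[K]_n).
Hypothesis PhiP : is_root_system Phi.
Variable F : divringClosed K.
Hypothesis PhiF :
  forall a b : 'rV[K]_n, a \in Phi -> b \in Phi -> cpair b a \in F.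
Variable B : 'I_n -> 'rV[K]_n.
Hypothesis BP : is_basis Phi B.
Hypothesis n_ge2 : (1 < n)%N.
Variable L : orderedLmodType F.
Implicit Types (a b : 'rV[K]_n) (x y z s t : model Phi L) (l : L).

(** Each nonzero [q i] requires at least [c] divided by its absolute value; the sum of these bounds
    serves all indices at once. *)
Lemma common_multiple (T : eqType) (r : seq T) (q : T -> subfield F) (c : L) :
  0 <= c -> exists2 l, 0 <= l & forall i, i \in r ->
    (0 < sfval (q i) -> c <= q i *: l) /\ (sfval (q i) < 0 -> q i *: l <= - c).
Proof.
move=> c0; elim: r => [|i r [l l0 lr]]; first by exists 0.
(* This is [c] divided by the absolute value of [q i]; for [q i = 0] the convention for the inverse
   makes it zero. *)
pose m := (if 0 < sfval (q i) then (q i)^-1 else - (q i)^-1) *: c.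
have sV : sfval ((q i)^-1) = (sfval (q i))^-1 by rewrite -[LHS]/(\val _)
  fmorphV.
have m0 : 0 <= m.
  apply: oscale_ge0 => //; case: ltP => qi.
    by have : 0 <= (sfval (q i))^-1; [rewrite invr_ge0 ltW | rewrite -sV].
  rewrite -[sfval _]/(\val _) rmorphN /= oppr_ge0.
  by have : (sfval (q i))^-1 <= 0; [rewrite invr_le0 | rewrite -sV].
have qs j (x : L) : sfval (q j) < 0 -> 0 <= x -> q j *: x <= 0.
  move=> qj x0; rewrite -[q j]opprK scaleNr oopp_le0; apply: oscale_ge0 => //.
  by rewrite -[sfval _]/(\val _) rmorphN /= oppr_ge0 ltW.
exists (l + m); first exact: le_trans l0 (oler_wpDr _ m0).
move=> j; rewrite inE => /orP[/eqP ->|/lr[h1 h2]]; rewrite scalerDr; split=> qj.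
- have q0 : q i != 0 by apply: contraTneq qj => ->; rewrite ltxx.
  rewrite /m qj scalerA mulfV // scale1r addrC; apply: oler_wpDr.
  by apply: oscale_ge0 => //; apply: ltW.
- have q0 : q i != 0 by apply: contraTneq qj => ->; rewrite ltxx.
  rewrite /m ltNge (ltW qj) /= scalerA mulrN mulfV // scaleN1r.
  by rewrite -[X in _ <= X]add0r olerD2; apply: qs.
- by apply: le_trans (h1 qj) (oler_wpDr _ _); apply: oscale_ge0 => //;
  apply: ltW.
- by rewrite -[X in _ <= X]addr0; apply: olerD; [apply: h2 | apply: qs].
Qed.

Lemma pairing_rho a l : a \in Phi ->
  pairing a (tens (rho F BP) l : model Phi L) = coroot a (rho F BP) *: l.
Proof. by move=> aP; rewrite (pairing_tens PhiF). Qed.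

Lemma fund_chamberD x y : fund_chamber B x -> fund_chamber B y ->
  fund_chamber B (x + y).
Proof.
move=> xC yC i; rewrite (pairingD PhiF) ?(basis_root BP) //.
exact: le_trans (xC i) (oler_wpDr _ (yC i)).
Qed.

(** Both the value on [rho] and the values on the chamber are combinations of the same coefficients,
    which all have one sign. *)
Lemma root_sign a : a \in Phi ->
  (0 < sfval (coroot a (rho F BP)) /\ forall x, fund_chamber B x ->
    0 <= pairing a x) \/
  (sfval (coroot a (rho F BP)) < 0 /\ forall x, fund_chamber B x ->
    pairing a x <= 0).
Proof.
move=> aP; have r0 := coroot_rho_neq0 PhiP PhiF BP aP.
have rE : sfval (coroot a (rho F BP)) =
    \sum_j sfval (coroot a (coweight F BP j)).
  by rewrite /rho (coroot_sum PhiF) // -[sfval _]/(\val _) rmorph_sum.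
have [sg|sg] := coroot_coweight_sign PhiP PhiF BP aP; [left|right]; split.
- by rewrite lt_def r0 rE sumr_ge0.
- move=> x xC; rewrite (pairing_decomp PhiP PhiF BP) //.
  by apply: osumr_ge0 => j _; apply: oscale_ge0 (sg j) (xC j).
- by rewrite lt_neqAle r0 rE sumr_le0.
- move=> x xC; rewrite -[pairing a x]opprK oopp_le0 (pairing_decomp PhiP PhiF
  BP) //.
  rewrite -sumrN; apply: osumr_ge0 => j _; rewrite -scaleNr.
  by apply: oscale_ge0 (xC j); rewrite -[sfval _]/(\val _) rmorphN /= oppr_ge0.
Qed.

(** Moving far along [rho] outweighs [lam] and the translation part of [w], for all roots at once;
    adding a chamber vector [c] only pushes each pairing further in the same direction. *)
Lemma chamber_deep (lam : L) (w : model Phi L -> model Phi L) : 0 < lam ->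
  affW w ->
  exists2 s, fund_chamber B s & forall c, fund_chamber B c ->
    deep lam (w s) (w (s + c)).
Proof.
move=> lam0 /affWP[u uW [t ->]].
have [b b0 bt] := obounded Phi (fun a => pairing a t).
have c0 : 0 <= lam + b by rewrite (le_trans (ltW lam0)) // oler_wpDr.
have [l l0 lP] := common_multiple Phi (fun a => coroot a (rho F BP)) c0.
exists (tens (rho F BP) l).
  move=> i; have BiP := basis_root BP i; rewrite pairing_rho //.
  suff -> : coroot (B i) (rho F BP) = 1 by rewrite scale1r.
  rewrite /rho (coroot_sum PhiF) // (bigD1 i) //= (coroot_coweight PhiP PhiF)
    eqxx.
  rewrite big1 ?addr0 // => j ji.
  by rewrite (coroot_coweight PhiP PhiF) (negPf ji).
move=> c cC a aP; have [g gP gE] := linW_root PhiP PhiF uW aP.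
have [bt1 bt2] := bt a aP; have [lp ln] := lP g gP.
have tE y : pairing a (t + u y) = pairing a t + pairing g y.
  by rewrite (pairingD PhiF) // gE.
rewrite !tE (pairingD PhiF) // pairing_rho //.
have [[/lp h sg]|[/ln h sg]] := root_sign gP; [left|right].
  have H : lam <= pairing a t + coroot g (rho F BP) *: l.
    apply: le_trans (olerD bt1 h).
    by rewrite addrCA addNr addr0.
  by split=> //; rewrite addrA; apply: le_trans H (oler_wpDr _ (sg _ cC)).
have H : pairing a t + coroot g (rho F BP) *: l <= - lam.
  apply: le_trans (olerD bt2 h) _.
  by rewrite opprD addrCA subrr addr0.
split=> //; rewrite addrA -[X in _ <= X]addr0; exact: olerD (sg _ cC).
Qed.

Variable d : model Phi L -> model Phi L -> L.
Hypothesis d_metric : is_metric d.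
Hypothesis d_inv : W_invariant d.
Hypothesis d_compat : weyl_compatible B d.

(** Some root takes different values at [x] and [y]. Weyl compatibility makes the segment meet the
    hyperplane at the mean of these values, which contains neither endpoint. *)
Lemma dist_split x y : x <> y ->
  exists z, [/\ z <> x, z <> y & d x y = d x z + d z y].
Proof.
move=> xy; have [a aP axy] : exists2 a, a \in Phi & pairing a x <> pairing a y.
  apply: contrapT => nex; apply: xy; apply: (pairing_inj PhiP PhiF BP) => a aP.
  by apply: contrapT => axy; apply: nex; exists a.
have [l ll] := ohalf (pairing a x + pairing a y).
have [p pl] := pairing_surj PhiP PhiF l aP.
pose rf := tmap (@span_refl K n F Phi a) : model Phi L -> model Phi L.
have Hp : affine_fix a (p - rf p) p by rewrite /affine_fix /= subrK.
have mid (u v : L) : u < v -> l + l = u + v -> u < l /\ l < v.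
  move=> uv E; split; rewrite oltNge -odouble_le E -oltNge ?oltD2 //.
  by rewrite [u + v]addrC oltD2.
have sep : separates (affine_fix a (p - rf p)) x y.
  exists a, (p - rf p), p; split=> //; rewrite pl.
  have [yx|nyx] := boolP (pairing a y <= pairing a x).
    right; apply: mid; last by rewrite ll addrC.
    by rewrite lt_neqAle yx andbT; apply/eqP => E; apply: axy.
  by left; apply: mid => //; rewrite oltNge.
have [|z [zxy zH]] := d_compat.2 _ _ _ _ sep; first by exists a, (p - rf p);
  split=> //; exists p.
have za : pairing a z = l.
  have := congr1 (pairing a) (zH : p - rf p + rf z = z).
  rewrite (pairingD PhiF) // (pairingB PhiF) // !(pairing_refl_self PhiP PhiF)
    //.
  rewrite pl opprK => E; have {}E : pairing a z + pairing a z = l + l.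
    by rewrite -{1}E -addrA addNr addr0.
  by apply/le_anti; rewrite -odouble_le E lexx /= -odouble_le E lexx.
exists z; split=> // zE; rewrite zE in za; apply: axy.
  by apply: (addrI (pairing a x)); rewrite -ll za.
by apply: (addIr (pairing a y)); rewrite -ll za.
Qed.

Lemma dist_gt0 x y : x <> y -> 0 < d x y.
Proof.
case: d_metric => d0 dE _ _ xy; rewrite lt_neqAle d0 andbT.
by apply/eqP => /esym/dE.
Qed.

(** Split the segment from 0 to [y] at [z], then the one from 0 to [z] at [z']. Twice the shorter
    piece of the latter is at most [d 0 z], which is less than [d 0 y]; if that piece ends at [z],
    it is translated to start at 0. *)
Lemma dist_gap (lam : L) : 0 < lam ->
  exists Y Z : model Phi L, Y <> 0 /\ d 0 Y + d 0 Y < d 0 Z.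
Proof.
move=> lam0; have aP := basis_root BP (Ordinal (ltnW n_ge2)).
have [y yl] := pairing_surj PhiP PhiF lam aP.
have y0 : 0 <> y.
  by move=> y0; move: yl lam0; rewrite -y0 (pairing0 PhiF) // => ->;
    rewrite ltxx.
have [z [z0 zy dz]] := dist_split y0.
have [z' [z'0 z'z dz']] := dist_split (nesym z0).
have zlt : d 0 z < d 0 y.
  have : 0 + d 0 z < d z y + d 0 z by rewrite oltD2 dist_gt0.
  by rewrite add0r dz addrC.
case/orP: (lmod_le_total (d 0 z') (d z' z)) => h.
  exists z', y; split=> //; apply: le_lt_trans zlt.
  by rewrite dz'; apply: olerD.
exists (z - z'), y; split; first by move/eqP; rewrite subr_eq0 => /eqP/esym.
have -> : d 0 (z - z') = d z' z.
  rewrite -(d_inv (affW_transl z')) addr0.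
  by rewrite addrC subrK.
apply: le_lt_trans zlt; by rewrite dz'; apply: olerD.
Qed.

End Metric.

(** * Distances and the main theorem *)

Section Distance.
Variables (K : realType) (n : nat) (F : divringClosed K) (Phi : seq 'rV[K]_n).
Variables (L : orderedLmodType F) (d : model Phi L -> model Phi L -> L).
Hypotheses (d_metric : is_metric d) (d_inv : W_invariant d).
Variables (X : Type) (charts : set (model Phi L -> X)).
Hypothesis charts_inj : forall f, charts f -> injective f.
Hypotheses (A2 : axiomA2 charts) (A3 : axiomA3 charts).

(** Two charts through the same two points differ there by an element of [affW], which preserves
    [d]. *)
Lemma dX_chart f x y : charts f -> dX d charts (f x) (f y) = d x y.
Proof.
move=> fC; apply: xget_unique; first by exists f, x, y.
move=> l [g [x' [y' [gC gx gy ->]]]].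
have [|_ [w wW wE]] := A2 fC gC; first by exists (f x); split;
  [exists x | exists x'].
have Ex : g (w x) = g x' by rewrite -wE ?gx //; exists x'.
have Ey : g (w y) = g y' by rewrite -wE ?gy //; exists y'.
by rewrite -(charts_inj gC Ex) -(charts_inj gC Ey) d_inv.
Qed.

(** Retract onto an apartment containing [p] and [s]: both stay fixed, the triangle inequality holds
    inside the apartment, and moving [q] there increases no distance. *)
Lemma axiomA5_TI : axiomA5 d charts -> axiomTI d charts.
Proof.
move=> A5 p q s; have [f [fC [x _ xp] [y _ ys]]] := A3 p s.
have [|rho [rf rid rle _]] := A5 f p fC; first by exists x.
have [z _ zq] := rf q.
have [rp rs] : rho p = p /\ rho s = s by split; apply: rid;
  [exists x | exists y].
have /le_trans : dX d charts p s <= dX d charts p (rho q) + dX d charts (rho q)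
  s.
  by rewrite -zq -xp -ys !dX_chart //; case: d_metric.
by apply; apply: olerD; [rewrite -{1}rp | rewrite -{1}rs].
Qed.

End Distance.

Theorem mainTheorem6 (K : realType) (n : nat) (n_ge2 : (1 < n)%N)
    (Phi : seq 'rV[K]_n) (PhiP : is_root_system Phi)
    (F : divringClosed K)
    (PhiF : forall a b, a \in Phi -> b \in Phi -> cpair b a \in F)
    (B : 'I_n -> 'rV[K]_n) (BP : is_basis Phi B)
    (L : orderedLmodType F)
    (lam : nat -> L) (lam_gt0 : 0 < lam 0%N)
    (lam_incr : forall k, lam k < lam k.+1)
    (lam_infty : forall x : L, exists N, forall k, (N <= k)%N -> x < lam k)
    (d : model Phi L -> model Phi L -> L)
    (d_metric : is_metric d) (d_inv : W_invariant d)
    (d_compat : weyl_compatible B d) :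
  exists (X : Type) (charts : set (model Phi L -> X)),
    modeled_space charts /\
    [/\ axiomA1 charts, axiomA2 charts, axiomA3 charts, axiomA4 B charts &
        axiomA6 charts] /\
    ~ axiomA5 d charts /\
    ~ axiomTI d charts.
Proof.
have [Y [Z [Y0 YZ]]] := dist_gap PhiP PhiF BP n_ge2 d_metric d_inv d_compat
  lam_gt0.
have aP := basis_root BP (Ordinal (ltnW n_ge2)); set a := B _ in aP.
have [b b0 bP] := obounded [:: Y; Z] (pairing a).
(* The threshold exceeds the absolute values of [a] at [Y] and [Z], so both points are shallow. *)
pose mu := lam 0%N + b.
have bmu : b < mu by rewrite /mu -{1}[b]add0r oltD2.
have mu0 : 0 < mu by apply: le_lt_trans b0 bmu.
have shallow x : x \in [:: Y; Z] -> ~ deep mu x x.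
  move=> /bP[h1 h2]; apply: (not_deep aP); last exact: le_lt_trans bmu.
  by apply: lt_le_trans h1; rewrite oltNge olerN2 -oltNge.
have [nY nZ] : ~ deep mu Y Y /\ ~ deep mu Z Z by split; apply: shallow;
  rewrite !inE eqxx ?orbT.
have n0 := not_deep0 PhiF BP n_ge2 mu0.
(* Shallow points are placed at [o = 0] and [e = Y]; the separating reflection is that of the first
   simple root. *)
have [X [J [f [i0 [i1 [finj fcov fint fjoin ffar]]]]]] :=
  free_space (linW_id Phi L)
  (linW_comp PhiF (L := L)) (linW_inv PhiP PhiF (L := L)) (@affW_lin _ _ _ _ _)
  (affW_inj PhiP PhiF (L := L))
  (fun x y => ex_intro2 _ _ _ (affW_transl (y - x)) (subrK x y))
  (@deep_sym _ _ _ _ _ mu) (deep_trans mu0) (deep_linW PhiP PhiF (lam := mu))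
  (refl0W BP n_ge2 L) (deep_refl0 PhiP PhiF BP mu0) (nesym Y0) n0 nY.
pose charts : set (model Phi L -> X) := [set g | exists j w,
  affW w /\ g = f j \o w].
have chartf j : charts (f j) by exists j, id; split=> //; exact: affW_id.
have inj g : charts g -> injective g.
  move=> [j [w [wW ->]]] x y /= /finj; exact: affW_inj.
have rangeE j w : affW w -> range (f j \o w) = range (f j).
  move=> /(affW_inv PhiP PhiF)[w' _ [wK _]]; apply/seteqP; split=> p [x _ <-];
    first by exists (w x).
  by exists (w' x) => //=; rewrite wK.
have A1 : axiomA1 charts.
  move=> g w [j [w1 [w1W ->]]] wW; exists j, (w1 \o w); split=> //.
  exact: affW_comp.
have A2 : axiomA2 charts.
  move=> g h [i [w1 [w1W ->]]] [j [w2 [w2W ->]]]; rewrite !rangeE //.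
  have [w2' w2'W [w2K Kw2]] := affW_inv PhiP PhiF w2W.
  (* Two charts of the same apartment overlap everywhere; otherwise the overlap is the preimage of
     one cell. *)
  have [<- _|ij [p [[x0 _ <-] [u _ E]]]] := pselect (i = j).
    split.
      rewrite (_ : _ @^-1` _ = setT); first exact: closed_convexT.
      by apply/seteqP; split=> // x _; exists (w1 x).
    exists (w2' \o w1) => [|x _ /=]; first exact: affW_comp.
    by rewrite w2K.
  have [w1' w1'W [w1K _]] := affW_inv PhiP PhiF w1W.
  have [cE [w wW wE]] := fint i j x0 u ij (esym E).
  have preE : (f i \o w1) @^-1` range (f j) = w1 @^-1` cell (deep mu) x0.
    apply/seteqP; split=> x /=; first by move=> [v _ vE]; apply/cE; exists v.
    by move=> /cE[v vE]; exists v.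
  rewrite preE; split.
    exact: closed_convex_preim (cell_closed_convex PhiP PhiF BP mu0 x0).
  exists (w2' \o (w \o w1)); first by do 2 apply: affW_comp => //.
  by move=> x /= /wE ->; rewrite w2K.
have A3 : axiomA3 charts.
  move=> p q; have [i [x <-]] := fcov p; have [j [y <-]] := fcov q.
  have [k [kx ky]] := fjoin i j x y.
  have [[x' ->] [y' ->]] := (kx x (or_introl erefl), ky y (or_introl erefl)).
  by exists (f k).
have A4 : axiomA4 B charts.
  have sub E : is_weyl_chamber_in B charts E -> exists i x E',
      is_subchamber_in B charts E' E /\ forall p, E' p ->
        exists2 z, cell (deep mu) x z & p = f i z.
    move=> [_ [S [[i [w [wW ->]]] [v vW ->] ->]]].
    have [s sC sD] := chamber_deep PhiP PhiF BP mu0 (affW_comp PhiF wW vW).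
    have [u uW [t vE]] := (affWP v).1 vW.
    (* Since [u] is the linear part of [v], translating by [u s] turns the chamber into the image
       under [v] of [s] plus the fundamental chamber, which [chamber_deep] puts in one cell. *)
    exists i, (w (v s)), ((f i \o w) @` translate (u s) (v @` fund_chamber B)).
    have vD c : u s + v c = v (s + c) by rewrite vE /= (linWD PhiF _ _ uW);
      exact: addrCA.
    split; last first.
      move=> _ [_ [_ [c cC <-] <-] <-]; exists (w (u s + v c)) => //.
      by right; rewrite vD; apply: sD.
    exists (f i \o w), (v @` fund_chamber B),
      (translate (u s) (v @` fund_chamber B)).
    split=> //; first by exists i, w.
      by exists v.
    split; first by exists (u s).
    by move=> _ [_ [c cC <-] <-]; rewrite vD; exists (s + c) => //;
      apply: fund_chamberD.
  move=> E1 E2 /sub[i [x [E1' [sE1 cE1]]]] /sub[j [y [E2' [sE2 cE2]]]].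
  have [k [kx ky]] := fjoin i j x y.
  exists E1', E2', (f k); split=> // p; [move/cE1|move/cE2] => -[z zc ->].
    by have [z' ->] := kx _ zc; exists z'.
  by have [z' ->] := ky _ zc; exists z'.
have A6 : axiomA6 charts.
  move=> g1 g2 g3 [i [w1 [w1W ->]]] [j [w2 [w2W ->]]] _; rewrite !rangeE //.
  move=> [_ [D [[k [w [wW ->]]] DH DE]]] _ _; exfalso.
  have [w' w'W [wK Kw]] := affW_inv PhiP PhiF wW.
  (* A half-apartment of one apartment lying in a different one would be contained in a single
     cell. *)
  have kP l : (f k \o w) @` D `<=` range (f l) -> k = l.
    move=> Dl; apply: contrapT => kl.
    have DH' := half_apartment_preim PhiP PhiF w'W DH.
    have no x := @half_apartment_not_cell _ _ _ PhiP _ PhiF _ BP n_ge2 _ _ mu0 _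
      x DH'.
    have DP y : D (w' y) -> exists v, f k y = f l v.
      move=> Dy; have [|v _ vE] := Dl (f k y); last by exists v.
      by exists (w' y) => //=; rewrite wK.
    (* The use of [no 0] only provides a point [x] of the half-apartment; its own cell then gives
       the contradiction. *)
    apply: (no 0) => x Dx; have [v xv] := DP x Dx.
    exfalso; apply: (no x) => y Dy; have [cE _] := fint k l x v kl xv.
    by apply/cE/DP.
  have ki : k = i by apply: kP; rewrite -DE; apply: subIsetl.
  have kj : k = j by apply: kP; rewrite -DE; apply: subIsetr.
  move: DE; rewrite -ki -kj setIid => DE.
  have [c [l [cP DE']]] := (half_apartmentP PhiP PhiF D).1 DH.
  (* The intersection is now a whole apartment, whereas a point with value [l - mu] lies outside
     [D]. *)
  have [x xl] := pairing_surj PhiP PhiF (l - mu) cP.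
  have : range (f k) (f k (w x)) by exists (w x).
  rewrite DE => -[y Dy] /finj /(affW_inj PhiP PhiF wW) yx.
  move: Dy; rewrite yx DE' /= xl -(osubr_ge0 l) addrAC subrr add0r.
  by apply/negP; rewrite -oltNge oopp_lt0.
have nTI : ~ axiomTI d charts.
  move=> /(_ (f i0 0) (f i1 0) (f i0 Z)).
  have distE := dX_chart d_inv inj A2.
  (* An apartment joining these two shallow points places them at 0 and [Y], in one order or the
     other. *)
  have far x : ~ deep mu x x -> dX d charts (f i0 x) (f i1 0) = d 0 Y /\
      dX d charts (f i1 0) (f i0 x) = d 0 Y.
    move=> nx; have [k [kx k0]] := fjoin i0 i1 x 0.
    have [[u xu] [v vE]] := (kx x (or_introl erefl), k0 0 (or_introl erefl)).
    have [_ _ dC _] := d_metric; rewrite xu vE !distE //.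
    by case: (ffar _ _ _ _ _ nx n0 (esym xu) (esym vE)) => -[-> ->];
      rewrite ?(dC Y).
  have [-> _] := far 0 n0; have [_ ->] := far Z nZ; rewrite distE //.
  by apply/negP; rewrite -oltNge.
exists X, charts; split; last by do 2 split=> //;
  move=> /(axiomA5_TI d_metric d_inv inj A2 A3).
split=> // p; have [i [x <-]] := fcov p; exists (f i) => //; by exists x.
Qed.
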